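(* Let $Z=(Z_1,Z_2)$ be a planar piecewise quadratic Kolmogorov system $$Z_i:\quad \dot{x} = x (a_i + b_i x + c_i y),\qquad \dot{y} = y (d_i + e_i x + f_i y),\qquad \text{if } (x,y)\in\Sigma_i=\{(x,y)\in\mathbb{R}^2 : (-1)^i h(x,y)>0\},\quad i=1,2,$$ with real coefficients and separation straight line $\Sigma=\{h=0\}$, and let $(x_0,y_0)\in\Sigma$ be a monodromic $CC$-equilibrium point, with $\det \mathrm{Jac}\, Z_i(x_0,y_0)=D_i^2$ for $i=1,2$. Then the following statements hold. (i) If $h(x,y)=x y_0-y x_0$, then $Z$ has a center at $(x_0,y_0)$ if and only if $$D_1^2D_2^2(b_1e_2-b_2e_1)-x_0^2D_1^2b_2e_1(b_2 - e_2)^2 + x_0^2D_2^2b_1e_2(b_1 - e_1)^2=0.$$ (ii) If $h(x,y)=y-y_0$, then $Z$ has a center at $(x_0,y_0)$ if and only if $$D_1^2b_2^2 - D_1^2b_2e_2 - D_2^2b_1^2 + D_2^2b_1e_1=0.$$ (iii) If $h(x,y)=x-x_0$, then $Z$ has a center at $(x_0,y_0)$ if and only if $$D_1^2D_2^2(b_1e_2 - b_2e_1) - x_0^2D_1^2b_2^2e_1(b_2 - e_2) + x_0^2D_2^2b_1^2e_2(b_1 - e_1)=0.$$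
   Context: A point $(x_0,y_0)\in\Sigma$ is a $CC$-equilibrium point if it is an equilibrium of both $Z_1$ and $Z_2$ (as vector fields on $\mathbb{R}^2$) and the Jacobian matrices $\mathrm{Jac}\,Z_1(x_0,y_0)$, $\mathrm{Jac}\,Z_2(x_0,y_0)$ both have nonzero purely imaginary eigenvalues (zero trace and positive determinant). It is monodromic if the trajectories of the piecewise system rotate around it (both vector fields rotate in the same direction), so that, taking $\Sigma$ as transversal section, a return map of the piecewise system is well defined near the point as the composition of the half-return maps of $Z_1$ in $\Sigma_1$ and $Z_2$ in $\Sigma_2$. The piecewise system $Z$ has a center at $(x_0,y_0)$ if this return map is the identity near the point, i.e. all trajectories of $Z$ in a punctured neighbourhood are periodic. *)

(* Defs.v *)
From Stdlib Require Import Reals.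
From Coquelicot Require Import Coquelicot.
Open Scope R_scope.

Definition kolmogorov (a b c d e f : R) (p : R * R) : R * R :=
  let (x, y) := p in (x * (a + b * x + c * y), y * (d + e * x + f * y)).

Record mat2 : Type := Mat2 { m11 : R; m12 : R; m21 : R; m22 : R }.

Definition det2 (A : mat2) : R := m11 A * m22 A - m12 A * m21 A.

Definition eigenvalue2 (A : mat2) (l : C) : Prop :=
  exists u v : C,
    (u, v) <> (RtoC 0, RtoC 0) /\
    (RtoC (m11 A) * u + RtoC (m12 A) * v = l * u)%C /\
    (RtoC (m21 A) * u + RtoC (m22 A) * v = l * v)%C.

(* [Derive] is total; the fields considered here are polynomial, so the
   partial derivatives below are genuine. *)
Definition Jac (F : R * R -> R * R) (p : R * R) : mat2 :=
  let (x, y) := p in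
  Mat2 (Derive (fun s => fst (F (s, y))) x) (Derive (fun s => fst (F (x, s))) y)
       (Derive (fun s => snd (F (s, y))) x) (Derive (fun s => snd (F (x, s))) y).

Definition straight_line (h : R * R -> R) : Prop :=
  exists l m n : R, (l, m) <> (0, 0) /\
    forall x y : R, h (x, y) = l * x + m * y + n.

Definition zone (h : R * R -> R) (i : nat) (p : R * R) : Prop :=
  (-1) ^ i * h p > 0.

Definition center_type (A : mat2) : Prop :=
  forall l : C, eigenvalue2 A l -> Re l = 0 /\ Im l <> 0.

Definition CC_equilibrium (Z1 Z2 : R * R -> R * R) (h : R * R -> R)
    (p0 : R * R) : Prop :=
  h p0 = 0 /\
  Z1 p0 = (0, 0) /\ Z2 p0 = (0, 0) /\
  center_type (Jac Z1 p0) /\ center_type (Jac Z2 p0).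

(* Cross product of p - p0 and F p, which is |p - p0|^2 times the derivative of the polar
   angle of p about p0 along F. *)
Definition angular (F : R * R -> R * R) (p0 p : R * R) : R :=
  (fst p - fst p0) * snd (F p) - (snd p - snd p0) * fst (F p).

Definition rotates_ccw (F : R * R -> R * R) (p0 : R * R) : Prop :=
  locally' p0 (fun p => angular F p0 p > 0).

Definition rotates_cw (F : R * R -> R * R) (p0 : R * R) : Prop :=
  locally' p0 (fun p => angular F p0 p < 0).

Definition monodromic (Z1 Z2 : R * R -> R * R) (p0 : R * R) : Prop :=
  (rotates_ccw Z1 p0 /\ rotates_ccw Z2 p0) \/
  (rotates_cw Z1 p0 /\ rotates_cw Z2 p0).

(* The derivatives at 0 and T are two-sided: F is a field on the whole plane,
   so its solutions extend slightly beyond [0, T]. *)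
Definition trajectory (F : R * R -> R * R) (T : R) (g : R -> R * R) : Prop :=
  forall t : R, 0 <= t <= T ->
    is_derive (fun s => fst (g s)) t (fst (F (g t))) /\
    is_derive (fun s => snd (g s)) t (snd (F (g t))).

(* Graph of the half-return map of F in zone i: q is the first point of the
   line reached by the forward orbit of p, which runs through zone i. *)
Definition half_return (F : R * R -> R * R) (h : R * R -> R) (i : nat)
    (p q : R * R) : Prop :=
  h p = 0 /\ h q = 0 /\
  exists (T : R) (g : R -> R * R),
    0 < T /\ trajectory F T g /\ g 0 = p /\ g T = q /\
    forall t : R, 0 < t < T -> zone h i (g t).

(* Graph of the return map.  The two cases correspond to the two half-lines
   of the section, according to the zone that the orbit of p enters first. *)
Definition return_map (Z1 Z2 : R * R -> R * R) (h : R * R -> R)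
    (p q : R * R) : Prop :=
  exists r : R * R,
    (half_return Z1 h 1 p r /\ half_return Z2 h 2 r q) \/
    (half_return Z2 h 2 p r /\ half_return Z1 h 1 r q).

(* Orbits are unique, so [return_map] is functional near a monodromic p0 and
   [return_map p p] says that the return map is defined at p and fixes it. *)
Definition has_center (Z1 Z2 : R * R -> R * R) (h : R * R -> R)
    (p0 : R * R) : Prop :=
  locally' p0 (fun p => h p = 0 -> return_map Z1 Z2 h p p).

(* Main.v *)
Require Import Defs.
From Stdlib Require Import Reals Psatz ClassicalEpsilon.
From Coquelicot Require Import Coquelicot.
Open Scope R_scope.

(** Each field is integrable near the equilibrium: it has zero trace there, and
    in the scaled coordinates X = x / x0, Y = y / y0 it admits the integrating
    factor M = X^(al-1) Y^(be-1), where al and be solve the linear system that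
    makes M times the field divergence-free.  So there is a first integral H with
    H_x = - M y' and H_y = M x' on the whole open quadrant containing the
    equilibrium ([kolmogorov_first_integral]), and this quadrant is invariant.

    Along the three lines of the theorem, X and Y are each equal to 1 or to the
    parameter s of the line, s = 1 being the equilibrium.  There
    dH/ds = kappa s^(g-1) (s - 1) with kappa <> 0 and g = al + be on the diagonal,
    g = al on y = y0, g = be on x = x0.  Hence the two points at which one orbit
    meets the line are exchanged by the involution defined by the function
    Phi_g (s), the integral of t^(g-1) (t - 1) from 1 to s
    ([half_return_section]).  The return map composes the involutions of the two
    fields, so the system has a center if and only if these agree.  They agree
    when the exponents are equal; conversely, if g < g' then Phi_g' - Phi_g is
    strictly increasing, so that a single pair of distinct points cannot be
    identified by both ([section_potential_exponent]).  Writing out the equality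
    of the two exponents gives the stated polynomial conditions.

    When the exponents agree, the half-return orbits must be produced, and they
    come from the first integral rather than from an existence theorem for
    differential equations.  In polar coordinates about the equilibrium H is
    strictly monotone along each ray, because its radial derivative is
    - M times the angular speed up to a positive factor.  Therefore a level curve
    is a graph rho = f (theta), it solves the equation of the orbits
    ([level_curve_solution]), and time is recovered along it as the integral of
    the inverse of the angular speed ([autonomous_passage]).  Half a turn of the
    angle leads from one half-line to the opposite one within one side of the
    line ([half_turn]). *)

(** * Involutions defined by power weights *)

(** The primitive of t^a on the positive half-line that vanishes at 1; the
    logarithmic case keeps every exponent admissible. *)
Definition power_primitive (a x : R) : R :=
  if Req_EM_T a (-1) then ln x else (Rpower x (a + 1) - 1) / (a + 1).

Lemma power_primitive_eq (a x : R) :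
  (a + 1) * power_primitive a x = Rpower x (a + 1) - 1.
Proof.
unfold power_primitive. destruct (Req_EM_T a (-1)) as [->|Ha].
- unfold Rpower. replace (-1 + 1) with 0 by ring.
  rewrite !Rmult_0_l, exp_0. ring.
- field. lra.
Qed.

Lemma Rpower_step (x a : R) : 0 < x -> Rpower x a = x * Rpower x (a - 1).
Proof.
intros Hx. rewrite <- (Rpower_1 x Hx) at 2. rewrite <- Rpower_plus.
f_equal. ring.
Qed.

Lemma is_derive_Rpower (a x : R) :
  0 < x -> is_derive (fun s => Rpower s a) x (a * Rpower x (a - 1)).
Proof.
intros Hx. apply is_derive_Reals. now apply derivable_pt_lim_power.
Qed.

Lemma is_derive_power_primitive (a x : R) :
  0 < x -> is_derive (power_primitive a) x (Rpower x a).
Proof.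
intros Hx. unfold power_primitive.
destruct (Req_EM_T a (-1)) as [->|Ha].
- replace (Rpower x (-1)) with (/ x)
    by (replace (-1) with (Ropp 1) by ring;
        now rewrite Rpower_Ropp, Rpower_1).
  apply is_derive_Reals. now apply derivable_pt_lim_ln.
- replace (Rpower x a) with ((a + 1) * Rpower x (a + 1 - 1) * / (a + 1)).
  2: { replace (a + 1 - 1) with a by ring. field. lra. }
  pose proof (is_derive_Rpower (a + 1) x Hx) as D.
  auto_derive.
  + now exists ((a + 1) * Rpower x (a + 1 - 1)).
  + rewrite (is_derive_unique (fun s : R => Rpower s (a + 1)) _ _ D). ring.
Qed.

Lemma is_derive_lt (f df : R -> R) (a b : R) :
  a < b ->
  (forall x, a <= x <= b -> is_derive f x (df x)) ->
  (forall x, a < x < b -> 0 < df x) ->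
  f a < f b.
Proof.
intros Hab Hd Hp.
destruct (MVT_cor2 f df a b Hab) as [c [Hc1 Hc2]].
- intros c Hc. apply is_derive_Reals. now apply Hd.
- specialize (Hp c Hc2). nra.
Qed.

Lemma is_derive_0_eq (f : R -> R) (a b : R) :
  a <= b -> (forall x, a <= x <= b -> is_derive f x 0) -> f a = f b.
Proof.
intros Hab Hd. destruct (Req_dec a b) as [->|Hne]; [reflexivity|].
destruct (MVT_cor2 f (fun _ => 0) a b) as [c [Hc1 Hc2]].
- lra.
- intros c Hc. apply is_derive_Reals. now apply Hd.
- lra.
Qed.

(** The integral of t^(g-1) (t - 1) from 1 to s: the restriction of a first
    integral to the section, up to a factor and a constant. *)
Definition section_potential (g s : R) : R :=
  power_primitive g s - power_primitive (g - 1) s.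

Lemma is_derive_section_potential (g s : R) :
  0 < s ->
  is_derive (section_potential g) s (Rpower s (g - 1) * (s - 1)).
Proof.
intros Hs. unfold section_potential.
pose proof (is_derive_minus _ _ _ _ _ (is_derive_power_primitive g s Hs)
  (is_derive_power_primitive (g - 1) s Hs)) as D.
rewrite (Rpower_step s g Hs) in D.
replace (Rpower s (g - 1) * (s - 1)) with
  (minus (s * Rpower s (g - 1)) (Rpower s (g - 1))); [exact D|].
unfold minus, plus, opp; simpl. ring.
Qed.

Lemma Rpower_pos (x a : R) : 0 < Rpower x a.
Proof. apply exp_pos. Qed.

Lemma section_potential_decr (g r s : R) :
  0 < r -> r < s -> s <= 1 -> section_potential g s < section_potential g r.
Proof.
intros Hr Hrs Hs.
enough (- section_potential g r < - section_potential g s) by lra.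
apply (is_derive_lt (fun x => - section_potential g x)
         (fun x => - (Rpower x (g - 1) * (x - 1)))); [exact Hrs| |].
- intros x Hx. apply (is_derive_opp (section_potential g)).
  apply is_derive_section_potential. lra.
- intros x Hx. pose proof (Rpower_pos x (g - 1)). nra.
Qed.

Lemma section_potential_incr (g r s : R) :
  1 <= r -> r < s -> section_potential g r < section_potential g s.
Proof.
intros Hr Hrs.
apply (is_derive_lt _ (fun x => Rpower x (g - 1) * (x - 1)));
  [exact Hrs| |].
- intros x Hx. apply is_derive_section_potential. lra.
- intros x Hx. pose proof (Rpower_pos x (g - 1)). nra.
Qed.

(** The potential falls before 1 and rises after it, so each side of 1 is a
    domain of injectivity. *)
Lemma section_potential_inj (g r s : R) :
  0 < r -> 0 < s -> 0 <= (r - 1) * (s - 1) ->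
  section_potential g r = section_potential g s -> r = s.
Proof.
intros Hr Hs Hside Heq.
destruct (Rle_lt_dec 1 r) as [H1|H1]; destruct (Rle_lt_dec 1 s) as [H2|H2];
  destruct (Rtotal_order r s) as [H|[H|H]]; try exact H; exfalso.
- pose proof (section_potential_incr g r s). lra.
- pose proof (section_potential_incr g s r). lra.
- lra.
- assert (r = 1) by nra. subst. pose proof (section_potential_decr g s 1). lra.
- assert (s = 1) by nra. subst. pose proof (section_potential_decr g r 1). lra.
- lra.
- pose proof (section_potential_decr g r s). lra.
- pose proof (section_potential_decr g s r). lra.
Qed.

(** The difference of the two potentials has derivative
    (t^(g'-1) - t^(g-1)) (t - 1), whose factors change sign together at 1. *)
Lemma section_potential_lt (g g' r s : R) :
  g < g' -> 0 < r -> r < s ->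
  section_potential g' r - section_potential g r
  < section_potential g' s - section_potential g s.
Proof.
intros Hg Hr Hrs.
(* The derivative vanishes at 1 only, where the interval is cut. *)
assert (Hmono : forall u v, 0 < u -> u < v -> (v <= 1 \/ 1 <= u) ->
  section_potential g' u - section_potential g u
  < section_potential g' v - section_potential g v).
{ intros u v Hu Huv Hside.
  apply (is_derive_lt
    (fun x => section_potential g' x - section_potential g x)
    (fun x => Rpower x (g' - 1) * (x - 1) - Rpower x (g - 1) * (x - 1)));
    [exact Huv| |].
  - intros x Hx.
    apply (is_derive_minus (section_potential g') (section_potential g));
      apply is_derive_section_potential; lra.
  - intros x Hx.
    destruct Hside as [Hv|Hv].
    + assert (Hp : Rpower x (g' - 1) < Rpower x (g - 1)).
      { unfold Rpower. apply exp_increasing.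
        assert (ln x < 0) by (rewrite <- ln_1; apply ln_increasing; lra).
        nra. }
      nra.
    + assert (Hp : Rpower x (g - 1) < Rpower x (g' - 1)).
      { apply Rpower_lt; lra. }
      nra. }
destruct (Rle_lt_dec s 1) as [H1|H1]; [apply Hmono; lra|].
destruct (Rle_lt_dec 1 r) as [H2|H2]; [apply Hmono; lra|].
apply Rlt_trans with (section_potential g' 1 - section_potential g 1);
  apply Hmono; lra.
Qed.

(** One pair of distinct points already determines the exponent: this is why a
    single periodic orbit off the equilibrium forces the center condition. *)
Lemma section_potential_exponent (g g' r s : R) :
  0 < r -> 0 < s -> r <> s ->
  section_potential g r = section_potential g s ->
  section_potential g' r = section_potential g' s ->
  g = g'.
Proof.
intros Hr Hs Hrs E1 E2.
destruct (Rtotal_order g g') as [H|[H|H]]; [exfalso|exact H|exfalso];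
  destruct (Rdichotomy _ _ Hrs) as [H'|H'].
- pose proof (section_potential_lt g g' r s). lra.
- pose proof (section_potential_lt g g' s r). lra.
- pose proof (section_potential_lt g' g r s). lra.
- pose proof (section_potential_lt g' g s r). lra.
Qed.

(** * Level curves as solutions *)

Lemma is_derive_continuous_eps (f : R -> R) (x l eps : R) :
  is_derive f x l -> 0 < eps ->
  exists d, 0 < d /\ forall s, Rabs (s - x) < d -> Rabs (f s - f x) < eps.
Proof.
intros Hf Heps.
assert (C : continuous f x) by (apply (ex_derive_continuous f); now exists l).
destruct (C (ball (f x) (mkposreal _ Heps)) (locally_ball _ _)) as [d Hd].
exists d. split; [apply cond_pos|]. intros s Hs. now apply Hd.
Qed.

Lemma segment_bounds (a b p q s : R) :
  a < p < b -> a < q < b -> 0 <= s <= 1 -> a < p + s * (q - p) < b.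
Proof.
intros Hp Hq Hs. destruct (Req_dec s 0) as [->|Hs0]; [lra|].
pose proof (Rmult_lt_0_compat s (q - a)).
pose proof (Rmult_lt_0_compat s (b - q)). nra.
Qed.

(** The hypothesis on G says dG = m (dy - r dx), that is, m is an integrating
    factor of y' = r (x, y).  Positivity of m makes G increasing in y, so
    the level set is a graph, and squeezing it between two horizontal segments
    gives continuity.  Its slope comes from the mean value theorem applied to G
    on a chord: the positive factor m cancels and the slope of the chord is the
    value of r at one of its points. *)
Lemma level_curve_solution (G m r : R -> R -> R) (c a b l u : R) :
  (forall (x y : R -> R) t dx dy,
     a < x t < b -> l < y t < u -> is_derive x t dx -> is_derive y t dy ->
     is_derive (fun s => G (x s) (y s)) t
       (m (x t) (y t) * (dy - r (x t) (y t) * dx))) ->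
  (forall x y, a < x < b -> l < y < u -> 0 < m x y) ->
  (forall x y, a < x < b -> l < y < u ->
     continuous (fun q : R * R => r (fst q) (snd q)) (x, y)) ->
  (forall x, a < x < b -> exists y, l < y < u /\ G x y = c) ->
  exists f : R -> R,
    (forall x, a < x < b ->
       l < f x < u /\ G x (f x) = c /\ is_derive f x (r x (f x))) /\
    (forall x y, a < x < b -> l < y < u -> G x y = c -> y = f x).
Proof.
intros HG Hm Hr Hex.
assert (mono : forall x y y', a < x < b -> l < y -> y < y' -> y' < u ->
  G x y < G x y').
{ intros x y y' Hx Hy Hyy Hy'.
  apply (is_derive_lt (G x) (fun z => m x z * (1 - r x z * 0))); [exact Hyy| |].
  - intros z Hz. apply (HG (fun _ => x) (fun s => s)); try lra.
    + apply @is_derive_const.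
    + apply @is_derive_id.
  - intros z Hz. assert (0 < m x z) by (apply Hm; lra). nra. }
exists (fun x => epsilon (inhabits 0) (fun y => l < y < u /\ G x y = c)).
set (f := fun x => _).
assert (Hf : forall x, a < x < b -> l < f x < u /\ G x (f x) = c).
{ intros x Hx. unfold f. apply epsilon_spec. now apply Hex. }
assert (Huniq : forall x y, a < x < b -> l < y < u -> G x y = c -> y = f x).
{ intros x y Hx Hy HGy. destruct (Hf x Hx) as [Hfx HGf].
  destruct (Rtotal_order y (f x)) as [H|[H|H]]; [|exact H|].
  - pose proof (mono x y (f x)). lra.
  - pose proof (mono x (f x) y). lra. }
split; [|exact Huniq].
intros x Hx. destruct (Hf x Hx) as [Hfx HGf].
split; [exact Hfx|split; [exact HGf|]].
assert (cont : forall eps, 0 < eps -> exists d, 0 < d /\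
  forall s, Rabs (s - x) < d -> a < s < b /\ Rabs (f s - f x) < eps).
{ intros eps Heps.
  set (e := Rmin (eps / 2) (Rmin ((f x - l) / 2) ((u - f x) / 2))).
  assert (He : 0 < e /\ e < eps /\ l < f x - e /\ f x + e < u).
  { unfold e, Rmin. repeat destruct Rle_dec; lra. }
  assert (Hd : forall y, l < y < u ->
    is_derive (fun s => G s y) x (m x y * (0 - r x y * 1))).
  { intros y Hy. apply (HG (fun s => s) (fun _ => y)); try lra.
    - apply @is_derive_id.
    - apply @is_derive_const. }
  assert (Hlow : G x (f x - e) < c) by (rewrite <- HGf; apply mono; lra).
  assert (Hup : c < G x (f x + e)) by (rewrite <- HGf; apply mono; lra).
  destruct (is_derive_continuous_eps _ _ _ (c - G x (f x - e))
              (Hd (f x - e) ltac:(lra)) ltac:(lra)) as [d1 [Hd1 H1]].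
  destruct (is_derive_continuous_eps _ _ _ (G x (f x + e) - c)
              (Hd (f x + e) ltac:(lra)) ltac:(lra)) as [d2 [Hd2 H2]].
  exists (Rmin (Rmin d1 d2) (Rmin (x - a) (b - x))).
  split. { unfold Rmin. repeat destruct Rle_dec; lra. }
  intros s Hs.
  assert (Rabs (s - x) < d1 /\ Rabs (s - x) < d2 /\ a < s < b) as [K1 [K2 K3]].
  { revert Hs. unfold Rmin, Rabs.
    repeat destruct Rle_dec; repeat destruct Rcase_abs; lra. }
  split; [exact K3|].
  specialize (H1 s K1). specialize (H2 s K2).
  apply Rabs_def2 in H1. apply Rabs_def2 in H2.
  destruct (Hf s K3) as [Hfs HGs].
  apply Rle_lt_trans with e; [|lra].
  apply Rabs_le.
  destruct (Rlt_le_dec (f s) (f x - e)) as [L|L].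
  { pose proof (mono s (f s) (f x - e)). lra. }
  destruct (Rlt_le_dec (f x + e) (f s)) as [L'|L'].
  { pose proof (mono s (f x + e) (f s)). lra. }
  lra. }
apply is_derive_Reals. intros eps Heps.
destruct (Hr x (f x) Hx Hfx (ball (r x (f x)) (mkposreal _ Heps))
            (locally_ball _ _)) as [d Hd].
destruct (cont d (cond_pos d)) as [d' [Hd' Hc]].
assert (Hmin : 0 < Rmin d d') by (apply Rmin_pos; [apply cond_pos|exact Hd']).
exists (mkposreal _ Hmin). intros k Hk0 Hk. simpl in Hk.
assert (Hkd : Rabs k < d) by (eapply Rlt_le_trans; [exact Hk|apply Rmin_l]).
assert (Hkd' : Rabs k < d') by (eapply Rlt_le_trans; [exact Hk|apply Rmin_r]).
destruct (Hc (x + k)) as [Hxk Hfk]; [now replace (x + k - x) with k by ring|].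
destruct (Hf _ Hxk) as [Hfxk HGxk].
set (D := f (x + k) - f x) in *.
set (X := fun s => x + s * k). set (Y := fun s => f x + s * D).
assert (Hbox : forall s, 0 <= s <= 1 -> a < X s < b /\ l < Y s < u).
{ intros s Hs. unfold X, Y, D.
  split; [|now apply segment_bounds].
  replace k with (x + k - x) by ring. now apply segment_bounds. }
destruct (MVT_cor2 (fun s => G (X s) (Y s))
  (fun s => m (X s) (Y s) * (D - r (X s) (Y s) * k)) 0 1) as [s [Hs1 Hs2]].
- lra.
- intros s Hs. apply is_derive_Reals. apply HG; try (now apply Hbox).
  + unfold X. auto_derive; [exact I|ring].
  + unfold Y. auto_derive; [exact I|ring].
- assert (Hslope : D = r (X s) (Y s) * k).
  { assert (E0 : G (X 0) (Y 0) = c).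
    { unfold X, Y. now rewrite !Rmult_0_l, !Rplus_0_r. }
    assert (E1 : G (X 1) (Y 1) = c).
    { unfold X, Y. rewrite !Rmult_1_l. unfold D.
      now replace (f x + (f (x + k) - f x)) with (f (x + k)) by ring. }
    destruct (Hbox s ltac:(lra)) as [B1 B2].
    pose proof (Hm _ _ B1 B2). rewrite E0, E1 in Hs1. nra. }
  replace (D / k) with (r (X s) (Y s)) by (rewrite Hslope; field; exact Hk0).
  apply (Hd (X s, Y s)). split.
  + change (Rabs (X s - x) < d). unfold X.
    replace (x + s * k - x) with (s * k) by ring.
    rewrite Rabs_mult, (Rabs_pos_eq s) by lra.
    pose proof (Rabs_pos k). nra.
  + change (Rabs (Y s - f x) < d). unfold Y.
    replace (f x + s * D - f x) with (s * D) by ring.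
    rewrite Rabs_mult, (Rabs_pos_eq s) by lra.
    pose proof (Rabs_pos D). nra.
Qed.

(** The time needed to reach y from a is the integral S of 1 / w, and the solution is
    the inverse of S.  That inverse is obtained as the level curve of S (y) - t,
    for which 1 / w is an integrating factor of y' = w (y). *)
Lemma autonomous_passage (w : R -> R) (a b a' b' : R) :
  a' < a -> a < b -> b < b' ->
  (forall y, a' < y < b' -> continuous w y) ->
  (forall y, a' < y < b' -> 0 < w y) ->
  exists (T : R) (f : R -> R),
    0 < T /\ f 0 = a /\ f T = b /\
    (forall t, 0 <= t <= T -> is_derive f t (w (f t))) /\
    (forall t, 0 < t < T -> a < f t < b).
Proof.
intros Ha Hab Hb Hc Hp.
set (S := fun y => RInt (fun z => / w z) a y).
assert (DS : forall y, a' < y < b' -> is_derive S y (/ w y)).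
{ intros y Hy. unfold S.
  assert (Hcont : forall z, a' < z < b' -> continuous (fun z => / w z) z).
  { intros z Hz. apply continuous_Rinv_comp; [now apply Hc|].
    pose proof (Hp z Hz). lra. }
  apply (is_derive_RInt (fun z => / w z) _ a); [|now apply Hcont].
  assert (Hrad : 0 < Rmin (y - a') (b' - y)) by (apply Rmin_pos; lra).
  exists (mkposreal _ Hrad). intros z Hz.
  apply @RInt_correct, @ex_RInt_continuous. intros v Hv. apply Hcont.
  change (Rabs (z - y) < Rmin (y - a') (b' - y)) in Hz.
  revert Hz Hv. unfold Rmin, Rmax, Rabs.
  repeat destruct Rle_dec; repeat destruct Rcase_abs; lra. }
assert (Smono : forall y z, a' < y -> y < z -> z < b' -> S y < S z).
{ intros y z H1 H2 H3. apply (is_derive_lt S (fun v => / w v)); [exact H2| |].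
  - intros v Hv. apply DS. lra.
  - intros v Hv. apply Rinv_0_lt_compat, Hp. lra. }
assert (Sa : S a = 0) by (exact (RInt_point a (fun z => / w z))).
set (l := (a' + a) / 2). set (u := (b + b') / 2).
assert (Hl : a' < l < a) by (unfold l; lra).
assert (Hu : b < u < b') by (unfold u; lra).
assert (S1 : S l < 0) by (rewrite <- Sa; apply Smono; lra).
assert (S2 : 0 < S b) by (rewrite <- Sa; apply Smono; lra).
assert (S3 : S b < S u) by (apply Smono; lra).
destruct (level_curve_solution (fun t y => S y - t) (fun _ y => / w y)
  (fun _ y => w y) 0 (S l) (S u) l u) as [f [Hf Huniq]].
- intros x y t dx dy Hx Hy Dx Dy.
  assert (Hyt : a' < y t < b') by lra.
  pose proof (is_derive_minus _ _ _ _ _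
    (is_derive_comp S y t _ _ (DS _ Hyt) Dy) Dx) as D.
  replace (/ w (y t) * (dy - w (y t) * dx)) with
    (minus (scal dy (/ w (y t))) dx); [exact D|].
  unfold minus, plus, opp, scal; simpl. unfold mult; simpl. field.
  pose proof (Hp _ Hyt). lra.
- intros x y Hx Hy. apply Rinv_0_lt_compat, Hp. lra.
- intros x y Hx Hy. apply (continuous_comp snd w).
  + apply continuous_snd.
  + apply Hc. simpl. lra.
- intros t Ht.
  assert (Hcont : forall y, l <= y <= u -> continuity_pt (fun y => S y - t) y).
  { intros y Hy. apply continuity_pt_filterlim.
    apply (ex_derive_continuous (fun y => S y - t)).
    exists (minus (/ w y) 0). apply (is_derive_minus S (fun _ => t)).
    - apply DS. lra.
    - apply @is_derive_const. }
  destruct (Ranalysis5.IVT_interv (fun y => S y - t) l u) as [y [Hy E]];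
    [exact Hcont|lra|lra|lra|].
  exists y. split; [|exact E].
  split; apply Rnot_le_lt; intros K.
  + assert (y = l) by lra. subst y. lra.
  + assert (y = u) by lra. subst y. lra.
- exists (S b), f.
  split; [exact S2|].
  split; [symmetry; apply Huniq; lra|].
  split; [symmetry; apply Huniq; lra|].
  split; [intros t Ht; apply Hf; lra|].
  intros t Ht. destruct (Hf t) as [K1 [K2 _]]; [lra|].
  split; apply Rnot_le_lt; intros K.
  + destruct (Rle_lt_or_eq_dec _ _ K) as [K'|K'].
    * pose proof (Smono (f t) a). lra.
    * rewrite K' in K2. lra.
  + destruct (Rle_lt_or_eq_dec _ _ K) as [K'|K'].
    * pose proof (Smono b (f t)). lra.
    * rewrite <- K' in K2. lra.
Qed.

(** * Half-turns around a rotation point *)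

Definition cross (v w : R * R) : R := fst v * snd w - snd v * fst w.

Definition polar (p0 w n : R * R) (th rho : R) : R * R :=
  (fst p0 + rho * (cos th * fst w + sin th * fst n),
   snd p0 + rho * (cos th * snd w + sin th * snd n)).

(** The derivative of H is prescribed along curves: H_x = - M F_2 and
    H_y = M F_1.  So H is constant on orbits, and M is an integrating factor
    of F. *)
Definition first_integral (U : R * R -> Prop) (F : R * R -> R * R)
    (H M : R * R -> R) : Prop :=
  (forall p, U p -> 0 < M p) /\
  (forall (x y : R -> R) t dx dy,
     U (x t, y t) -> is_derive x t dx -> is_derive y t dy ->
     is_derive (fun s => H (x s, y s)) t
       (M (x t, y t) * cross (F (x t, y t)) (dx, dy))).

Definition continuous_field (U : R * R -> Prop) (F : R * R -> R * R) : Prop :=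
  forall p, U p ->
    continuous (fun q => fst (F q)) p /\ continuous (fun q => snd (F q)) p.

(** Continuity of real functions of two real variables, in forms that can be
    applied by recursion on an expression. *)
Lemma continuous_R2 (f g : R * R -> R) (F : R * R -> R) (p : R * R) :
  continuous F (f p, g p) -> continuous f p -> continuous g p ->
  continuous (fun q => F (f q, g q)) p.
Proof.
intros HF Hf Hg. apply (continuous_comp_2 f g (fun x y => F (x, y)));
  try assumption.
apply (continuous_ext F); [now intros [x y]|exact HF].
Qed.

Lemma continuous_Rplus (f g : R * R -> R) p :
  continuous f p -> continuous g p -> continuous (fun q => f q + g q) p.
Proof. apply (continuous_plus f g). Qed.
Lemma continuous_Rminus (f g : R * R -> R) p :
  continuous f p -> continuous g p -> continuous (fun q => f q - g q) p.
Proof. apply (continuous_minus f g). Qed.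
Lemma continuous_Rmult (f g : R * R -> R) p :
  continuous f p -> continuous g p -> continuous (fun q => f q * g q) p.
Proof. apply (continuous_mult f g). Qed.

Lemma continuous_Rinv_R2 (f : R * R -> R) p :
  continuous f p -> f p <> 0 -> continuous (fun q => / f q) p.
Proof.
intros Hf Hp. apply (continuous_comp f Rinv); [exact Hf|].
now apply continuous_Rinv.
Qed.

Lemma continuous_fst_R (p : R * R) : continuous (fun q : R * R => fst q) p.
Proof. destruct p as [x y]. apply (continuous_fst x y). Qed.
Lemma continuous_snd_R (p : R * R) : continuous (fun q : R * R => snd q) p.
Proof. destruct p as [x y]. apply (continuous_snd x y). Qed.

Ltac continuity2 :=
  try assumption;
  match goal with
  | |- continuous (fun q => fst q) _ => apply continuous_fst_R
  | |- continuous (fun q => snd q) _ => apply continuous_snd_R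
  | |- continuous (fun q => cos (@?f q)) ?p =>
      apply (continuous_comp f cos p); [continuity2|apply continuous_cos]
  | |- continuous (fun q => sin (@?f q)) ?p =>
      apply (continuous_comp f sin p); [continuity2|apply continuous_sin]
  | |- continuous (fun q => - @?f q) ?p =>
      apply (continuous_opp f p); continuity2
  | |- continuous (fun q => @?f q + @?g q) ?p =>
      apply (continuous_Rplus f g p); continuity2
  | |- continuous (fun q => @?f q - @?g q) ?p =>
      apply (continuous_Rminus f g p); continuity2
  | |- continuous (fun q => @?f q * @?g q) ?p =>
      apply (continuous_Rmult f g p); continuity2
  | |- continuous (fun _ => ?c) ?p => apply (continuous_const c p)
  | _ => idtac
  end.

(** Here e is the direction of a ray, a its derivative with respect to the angle
    and v the field.  The angular speed [spin] and the radial slope [slope] of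
    the orbits recombine into v, by Cramer's rule in the basis (e, a). *)
Lemma polar_velocity (e a v : R * R) (r : R) :
  r <> 0 -> cross e a <> 0 -> cross e v <> 0 ->
  let spin := cross e v * / (r * cross e a) in
  let slope := r * cross v a * / cross e v in
  spin * slope * fst e + r * spin * fst a = fst v /\
  spin * slope * snd e + r * spin * snd a = snd v.
Proof. unfold cross. intros Hr Ha Hv. split; field; auto. Qed.

(** The frame (w, n) is arbitrary up to its orientation, which is chosen so that
    the angle increases with time.  The radius of the starting
    point is taken so small that its level stays below the minimum of the first
    integral on a full arc of radius [dl]; every ray of the arc then meets
    that level.  The angle interval is [-1, PI + 1] rather than [0, PI] because
    a trajectory has two-sided derivatives at its ends.  The bound [rad] makes
    the end point tend to the equilibrium with the starting point. *)
Lemma half_turn (F : R * R -> R * R) (p0 w n : R * R) (H M : R * R -> R)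
    (sg eps : R) :
  0 < eps ->
  first_integral (ball p0 eps) F H M ->
  continuous_field (ball p0 eps) F ->
  (forall p, ball p0 eps p -> p <> p0 -> 0 < sg * angular F p0 p) ->
  0 < sg * cross w n ->
  forall rad, 0 < rad ->
  exists eta, 0 < eta /\ forall tau, 0 < tau < eta ->
  exists (tau' T : R) (g : R -> R * R),
    0 < tau' < rad /\ 0 < T /\ trajectory F T g /\
    g 0 = polar p0 w n 0 tau /\ g T = polar p0 w n PI tau' /\
    (forall t, 0 < t < T ->
       exists rho th, 0 < rho /\ 0 < th < PI /\ g t = polar p0 w n th rho).
Proof.
intros Heps [HM HH] HF Hang Hk rad Hrad.
set (P := polar p0 w n).
set (K := Rabs (fst w) + Rabs (fst n) + Rabs (snd w) + Rabs (snd n) + 1).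
assert (HK : 1 <= K).
{ unfold K. pose proof (Rabs_pos (fst w)). pose proof (Rabs_pos (fst n)).
  pose proof (Rabs_pos (snd w)). pose proof (Rabs_pos (snd n)). lra. }
set (dl := Rmin rad (eps / K) / 2).
assert (Hdl : 0 < dl /\ dl < rad /\ dl * K < eps).
{ assert (0 < eps / K) by (apply Rdiv_lt_0_compat; lra).
  assert (E : eps / K * K = eps) by (field; lra).
  unfold dl, Rmin. destruct Rle_dec; split; try split; nra. }
assert (Hball : forall th rho, Rabs rho <= dl -> ball p0 eps (P th rho)).
{ intros th rho Hrho.
  assert (Hc : forall x y, Rabs x + Rabs y <= K ->
            Rabs (rho * (cos th * x + sin th * y)) < eps).
  { intros x y Hxy. rewrite Rabs_mult.
    assert (Rabs (cos th * x + sin th * y) <= K).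
    { eapply Rle_trans; [apply Rabs_triang|]. rewrite !Rabs_mult.
      pose proof (Rabs_pos x). pose proof (Rabs_pos y).
      assert (Rabs (cos th) <= 1) by (apply Rabs_le; apply COS_bound).
      assert (Rabs (sin th) <= 1) by (apply Rabs_le; apply SIN_bound).
      nra. }
    pose proof (Rabs_pos rho).
    pose proof (Rabs_pos (cos th * x + sin th * y)). nra. }
  pose proof (Rabs_pos (fst w)). pose proof (Rabs_pos (fst n)).
  pose proof (Rabs_pos (snd w)). pose proof (Rabs_pos (snd n)).
  split.
  - change (Rabs (fst (P th rho) - fst p0) < eps). unfold P, polar; simpl.
    replace (fst p0 + rho * (cos th * fst w + sin th * fst n) - fst p0)
      with (rho * (cos th * fst w + sin th * fst n)) by ring.
    apply Hc. unfold K. lra.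
  - change (Rabs (snd (P th rho) - snd p0) < eps). unfold P, polar; simpl.
    replace (snd p0 + rho * (cos th * snd w + sin th * snd n) - snd p0)
      with (rho * (cos th * snd w + sin th * snd n)) by ring.
    apply Hc. unfold K. lra. }
set (d := fun th => (cos th * fst w + sin th * fst n,
                     cos th * snd w + sin th * snd n)).
set (d' := fun th => (- sin th * fst w + cos th * fst n,
                      - sin th * snd w + cos th * snd n)).
set (k := cross w n) in *.
assert (Hdd' : forall th, cross (d th) (d' th) = k).
{ intros th. unfold cross, d, d', k, cross; simpl.
  pose proof (sin2_cos2 th) as E. unfold Rsqr in E.
  transitivity ((sin th * sin th + cos th * cos th)
                * (fst w * snd n - snd w * fst n)); [ring|rewrite E; ring]. }
assert (Hk0 : k <> 0) by (intros E; rewrite E in Hk; lra).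
assert (Hne : forall th rho, 0 < rho -> P th rho <> p0).
{ intros th rho Hrho E. apply Hk0. rewrite <- (Hdd' th).
  assert (E1 : fst (d th) = 0).
  { apply (f_equal fst) in E. unfold P, polar in E; simpl in E.
    unfold d; simpl. nra. }
  assert (E2 : snd (d th) = 0).
  { apply (f_equal snd) in E. unfold P, polar in E; simpl in E.
    unfold d; simpl. nra. }
  unfold cross. rewrite E1, E2. ring. }
assert (Hturn : forall th rho, 0 < rho <= dl ->
          0 < sg * cross (d th) (F (P th rho))).
{ intros th rho Hrho.
  assert (A : 0 < sg * angular F p0 (P th rho)).
  { apply Hang; [apply Hball; rewrite Rabs_pos_eq; lra|].
    apply Hne. lra. }
  replace (angular F p0 (P th rho)) with (rho * cross (d th) (F (P th rho)))
    in A by (unfold angular, cross, d, P, polar; simpl; ring).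
  apply Rmult_lt_reg_l with rho; [lra|]. lra. }
assert (Hcross : forall th rho, 0 < rho <= dl ->
          cross (d th) (F (P th rho)) <> 0).
{ intros th rho Hrho E. pose proof (Hturn th rho Hrho) as A.
  rewrite E in A. lra. }
(* In polar coordinates the orbits solve drho/dth = slope, and the angle
   turns at speed spin. *)
set (G := fun th rho => - sg * H (P th rho)).
set (m := fun th rho => M (P th rho) * (sg * cross (d th) (F (P th rho)))).
set (slope := fun th rho =>
  rho * cross (F (P th rho)) (d' th) * / cross (d th) (F (P th rho))).
set (spin := fun th rho => cross (d th) (F (P th rho)) * / (rho * k)).
assert (HdP : forall (x y : R -> R) t dx dy,
  is_derive x t dx -> is_derive y t dy ->
  is_derive (fun s => fst (P (x s) (y s))) t
    (dy * fst (d (x t)) + y t * dx * fst (d' (x t))) /\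
  is_derive (fun s => snd (P (x s) (y s))) t
    (dy * snd (d (x t)) + y t * dx * snd (d' (x t)))).
{ intros x y t dx dy Dx Dy.
  assert (Ex : ex_derive x t) by (now exists dx).
  assert (Ey : ex_derive y t) by (now exists dy).
  unfold P, polar, d, d'; simpl; split; auto_derive; try tauto;
    rewrite (is_derive_unique (fun s : R => x s) _ _ Dx),
            (is_derive_unique (fun s : R => y s) _ _ Dy); ring. }
assert (HdG : forall (x y : R -> R) t dx dy, Rabs (y t) <= dl ->
  is_derive x t dx -> is_derive y t dy ->
  is_derive (fun s => G (x s) (y s)) t
    (M (P (x t) (y t)) * (sg * cross (d (x t)) (F (P (x t) (y t))) * dy
     - sg * y t * dx * cross (F (P (x t) (y t))) (d' (x t))))).
{ intros x y t dx dy Hy Dx Dy. destruct (HdP x y t dx dy Dx Dy) as [D1 D2].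
  pose proof (HH _ _ t _ _ (Hball (x t) (y t) Hy) D1 D2) as D.
  unfold G.
  pose proof (is_derive_scal _ _ (- sg) _ D) as D3.
  match type of D3 with is_derive _ _ ?l =>
    match goal with |- is_derive _ _ ?l' =>
      replace l' with l; [exact D3|] end end.
  rewrite <- !surjective_pairing. unfold cross; simpl. ring. }
assert (Hpos : forall th rho, 0 < rho <= dl -> 0 < m th rho).
{ intros th rho Hrho. apply Rmult_lt_0_compat; [|now apply Hturn].
  apply HM, Hball. rewrite Rabs_pos_eq; lra. }
assert (Hrho : forall th rho, Rabs rho <= dl -> is_derive (G th) rho (m th rho)).
{ intros th rho Hrho.
  pose proof (HdG (fun _ => th) (fun s => s) rho 0 1 Hrho
    (is_derive_const _ _) (is_derive_id _)) as D.
  match type of D with is_derive _ _ ?l => replace (m th rho) with l;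
    [exact D|] end. unfold m. ring. }
assert (Gmono : forall th r1 r2, 0 <= r1 -> r1 < r2 -> r2 <= dl ->
          G th r1 < G th r2).
{ intros th r1 r2 H1 H2 H3. apply (is_derive_lt _ (m th)); [exact H2| |].
  - intros r Hr. apply Hrho. rewrite Rabs_pos_eq; lra.
  - intros r Hr. apply Hpos. lra. }
assert (G0 : forall th, G th 0 = G 0 0).
{ intros th. unfold G, P, polar. now rewrite !Rmult_0_l. }
destruct (continuity_ab_min (fun th => G th dl) (-1) (PI + 1))
  as [thm [Hmin Hthm]].
{ pose proof PI_RGT_0. lra. }
{ intros th Hth. apply continuity_pt_filterlim.
  apply (ex_derive_continuous (fun th => G th dl)). eexists.
  apply (HdG (fun s => s) (fun _ => dl) th 1 0).
  - rewrite Rabs_pos_eq; lra.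
  - apply @is_derive_id.
  - apply @is_derive_const. }
assert (Hlevel : 0 < G thm dl - G 0 0).
{ rewrite <- (G0 thm). pose proof (Gmono thm 0 dl). lra. }
destruct (is_derive_continuous_eps _ _ _ _
  (Hrho 0 0 ltac:(rewrite Rabs_R0; lra)) Hlevel) as [eta [Heta Hc]].
exists (Rmin eta dl). split; [apply Rmin_pos; lra|].
intros tau [Htau0 Htau].
assert (Htau1 : tau < eta) by (eapply Rlt_le_trans; [exact Htau|apply Rmin_l]).
assert (Htau2 : tau < dl) by (eapply Rlt_le_trans; [exact Htau|apply Rmin_r]).
assert (Hc0 : G 0 0 < G 0 tau) by (apply Gmono; lra).
assert (Hc1 : G 0 tau < G thm dl).
{ specialize (Hc tau). rewrite Rminus_0_r, Rabs_pos_eq in Hc by lra.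
  apply Rabs_def2 in Hc; lra. }
assert (HcontP : forall th rho,
  continuous (fun q : R * R => fst (P (fst q) (snd q))) (th, rho) /\
  continuous (fun q : R * R => snd (P (fst q) (snd q))) (th, rho)).
{ intros th rho. unfold P, polar; simpl. split; continuity2. }
assert (HcontF : forall th rho, 0 < rho < dl ->
  continuous (fun q : R * R => fst (F (P (fst q) (snd q)))) (th, rho) /\
  continuous (fun q : R * R => snd (F (P (fst q) (snd q)))) (th, rho)).
{ intros th rho Hr.
  assert (Hr' : Rabs rho <= dl) by (rewrite Rabs_pos_eq; lra).
  destruct (HF _ (Hball th rho Hr')) as [F1 F2].
  destruct (HcontP th rho) as [C1 C2].
  rewrite (surjective_pairing (P th rho)) in F1, F2.
  split.
  - exact (continuous_R2 _ _ (fun q => fst (F q)) (th, rho) F1 C1 C2).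
  - exact (continuous_R2 _ _ (fun q => snd (F q)) (th, rho) F2 C1 C2). }
assert (Hcontd : forall th rho, 0 < rho < dl ->
  continuous (fun q : R * R => cross (d (fst q)) (F (P (fst q) (snd q))))
    (th, rho)).
{ intros th rho Hr. destruct (HcontF th rho Hr) as [F1 F2].
  unfold cross, d; simpl. continuity2. }
destruct (level_curve_solution G m slope (G 0 tau) (-1) (PI + 1) 0 dl)
  as [f [Hf Huniq]].
- intros x y t dx dy Hx Hy Dx Dy.
  assert (Hr : Rabs (y t) <= dl) by (rewrite Rabs_pos_eq; lra).
  pose proof (HdG x y t dx dy Hr Dx Dy) as D.
  match type of D with is_derive _ _ ?l =>
    match goal with |- is_derive _ _ ?l' =>
      replace l' with l; [exact D|] end end.
  unfold m, slope. field. apply Hcross. lra.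
- intros th rho Hth Hr. apply Hpos. lra.
- intros th rho Hth Hr. destruct (HcontF th rho Hr) as [F1 F2].
  unfold slope. apply continuous_Rmult.
  + apply continuous_Rmult; [apply continuous_snd_R|].
    unfold cross, d'; simpl. continuity2.
  + apply continuous_Rinv_R2; [now apply Hcontd|]. apply Hcross. simpl; lra.
- intros th Hth.
  assert (Hcont : forall r, 0 <= r <= dl ->
            continuity_pt (fun r => G th r - G 0 tau) r).
  { intros r Hr. apply continuity_pt_filterlim.
    apply (ex_derive_continuous (fun r => G th r - G 0 tau)). eexists.
    apply (is_derive_minus (G th) (fun _ => G 0 tau)).
    - apply Hrho. rewrite Rabs_pos_eq; lra.
    - apply @is_derive_const. }
  assert (Hend : G thm dl <= G th dl) by (apply Hmin; lra).
  destruct (Ranalysis5.IVT_interv (fun r => G th r - G 0 tau) 0 dl)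
    as [r [Hr E]]; [exact Hcont|lra|rewrite G0; lra|lra|].
  exists r. split; [|lra].
  split; apply Rnot_le_lt; intros Hle.
  + assert (r = 0) by lra. subst r. rewrite G0 in E. lra.
  + assert (r = dl) by lra. subst r. lra.
- pose proof PI_RGT_0 as HPI.
  assert (Hspin : forall th, -1 < th < PI + 1 -> 0 < spin th (f th)).
  { intros th Hth. destruct (Hf th Hth) as [Hr _]. unfold spin.
    replace (cross (d th) (F (P th (f th))) * / (f th * k))
      with ((sg * cross (d th) (F (P th (f th)))) / (f th * (sg * k))).
    - apply Rdiv_lt_0_compat; [apply Hturn; lra|].
      apply Rmult_lt_0_compat; [lra|exact Hk].
    - field. repeat split; [exact Hk0|lra|]. intros E. rewrite E in Hk. lra. }
  destruct (autonomous_passage (fun th => spin th (f th)) 0 PI (-1) (PI + 1))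
    as [T [ang [HT [A0 [AT [Dang Hin]]]]]]; [lra|lra|lra| |exact Hspin|].
  { intros th Hth. destruct (Hf th Hth) as [Hr [_ Df]].
    apply (continuous_comp_2 (fun th => th) f spin).
    - apply continuous_id.
    - apply (ex_derive_continuous f). eexists. exact Df.
    - unfold spin. apply continuous_Rmult; [now apply Hcontd|].
      apply continuous_Rinv_R2; simpl.
      + continuity2.
      + apply Rmult_integral_contrapositive. split; [lra|exact Hk0]. }
  assert (Hang' : forall t, 0 <= t <= T -> 0 <= ang t <= PI).
  { intros t Ht. destruct (Req_dec t 0) as [->|N0]; [lra|].
    destruct (Req_dec t T) as [->|NT]; [lra|]. pose proof (Hin t). lra. }
  exists (f PI), T, (fun t => P (ang t) (f (ang t))).
  split. { destruct (Hf PI) as [Hr _]; lra. }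
  split; [exact HT|]. split.
  { intros t Ht. specialize (Hang' t Ht).
    destruct (Hf (ang t)) as [Hr [_ Df]]; [lra|].
    specialize (Dang t Ht).
    pose proof (is_derive_comp f ang t _ _ Df Dang) as Dr.
    destruct (HdP ang (fun s => f (ang s)) t _ _ Dang Dr) as [D1 D2].
    unfold scal in D1, D2; simpl in D1, D2; unfold mult in D1, D2;
      simpl in D1, D2.
    pose proof (Hcross (ang t) (f (ang t)) ltac:(lra)) as Hx.
    destruct (polar_velocity (d (ang t)) (d' (ang t))
      (F (P (ang t) (f (ang t)))) (f (ang t))) as [V1 V2];
      [lra|now rewrite Hdd'|exact Hx|].
    rewrite Hdd' in V1, V2.
    rewrite <- V1, <- V2. split; [exact D1|exact D2]. }
  split; [rewrite A0; f_equal; symmetry; apply Huniq; lra|].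
  split; [now rewrite AT|].
  intros t Ht. exists (f (ang t)), (ang t).
  specialize (Hin t Ht). destruct (Hf (ang t)) as [Hr _]; [lra|].
  repeat split; lra.
Qed.

(** * Centers of piecewise systems with power sections *)

Definition section_point (p0 W : R * R) (s : R) : R * R :=
  (fst p0 + (s - 1) * fst W, snd p0 + (s - 1) * snd W).

Definition invariant (U : R * R -> Prop) (F : R * R -> R * R) : Prop :=
  forall T g, trajectory F T g -> U (g 0) ->
  forall t, 0 <= t <= T -> U (g t).

(** The product in the last clause is the derivative of H along the section line,
    so H restricts there to kappa times the potential of exponent g, up to a
    constant. *)
Definition power_section (U : R * R -> Prop) (F : R * R -> R * R)
    (p0 W : R * R) (g : R) : Prop :=
  continuous_field U F /\ invariant U F /\
  exists (H M : R * R -> R) (kappa : R),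
    first_integral U F H M /\ kappa <> 0 /\
    forall s, 0 < s ->
      M (section_point p0 W s) * cross (F (section_point p0 W s)) W
      = kappa * (Rpower s (g - 1) * (s - 1)).

(** The line h = 0 parametrized affinely with p0 at s = 1, in such a way that it
    lies in U exactly for s > 0, where powers of s make sense. *)
Definition section_frame (U : R * R -> Prop) (h : R * R -> R)
    (p0 W : R * R) (mu : R) : Prop :=
  locally p0 U /\ (forall s, U (section_point p0 W s) <-> 0 < s) /\
  W <> (0, 0) /\ mu <> 0 /\
  (forall p, h p = mu * cross (fst p - fst p0, snd p - snd p0) W).

Lemma sum_sqr_pos (W : R * R) : W <> (0, 0) -> 0 < fst W ^ 2 + snd W ^ 2.
Proof.
intros HW. destruct W as [w1 w2]; simpl.
destruct (Req_dec w1 0) as [->|H1]; [|nra].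
destruct (Req_dec w2 0) as [->|H2]; [now contradict HW|nra].
Qed.

Lemma cross_0_section_point (p0 W p : R * R) :
  W <> (0, 0) -> cross (fst p - fst p0, snd p - snd p0) W = 0 ->
  p = section_point p0 W
        (1 + ((fst p - fst p0) * fst W + (snd p - snd p0) * snd W)
             / (fst W ^ 2 + snd W ^ 2)).
Proof.
intros HW Hc. pose proof (sum_sqr_pos W HW) as HN.
destruct p as [x y], p0 as [x0 y0], W as [w1 w2].
unfold cross in Hc; unfold section_point; cbn [fst snd] in *.
set (z := (x - x0) * w1 + (y - y0) * w2). set (N := w1 ^ 2 + w2 ^ 2) in *.
assert (E1 : z * w1 = (x - x0) * N).
{ apply Rminus_diag_uniq. unfold z, N.
  transitivity (- w2 * ((x - x0) * w2 - (y - y0) * w1)); [ring|].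
  rewrite Hc. ring. }
assert (E2 : z * w2 = (y - y0) * N).
{ apply Rminus_diag_uniq. unfold z, N.
  transitivity (w1 * ((x - x0) * w2 - (y - y0) * w1)); [ring|].
  rewrite Hc. ring. }
f_equal.
- replace (x0 + (1 + z / N - 1) * w1) with (x0 + z * w1 / N) by (field; lra).
  rewrite E1. field. lra.
- replace (y0 + (1 + z / N - 1) * w2) with (y0 + z * w2 / N) by (field; lra).
  rewrite E2. field. lra.
Qed.

Lemma section_point_inj (p0 W : R * R) (u v : R) :
  W <> (0, 0) -> section_point p0 W u = section_point p0 W v -> u = v.
Proof.
intros HW E. pose proof (sum_sqr_pos W HW) as HN.
pose proof (f_equal fst E) as X1. pose proof (f_equal snd E) as X2.
unfold section_point in X1, X2; simpl in *.
apply Rminus_diag_uniq.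
assert (Y1 : (u - v) * fst W = 0) by lra.
assert (Y2 : (u - v) * snd W = 0) by lra.
assert (Y : (u - v) * (fst W ^ 2 + snd W ^ 2) = 0).
{ transitivity ((u - v) * fst W * fst W + (u - v) * snd W * snd W);
    [ring|].
  rewrite Y1, Y2. ring. }
apply Rmult_integral in Y. simpl in Y, HN. destruct Y; [assumption|lra].
Qed.

(** Used at both ends of a half-return, to detect tangency to the line. *)
Lemma right_derivative_ge0 (f : R -> R) (T v : R) :
  0 < T -> f 0 = 0 -> (forall t, 0 < t < T -> 0 < f t) ->
  is_derive f 0 v -> 0 <= v.
Proof.
intros HT H0 Hp Hd. apply Rnot_lt_le. intros Hv.
apply is_derive_Reals in Hd.
destruct (Hd (- v) ltac:(lra)) as [d Hdel].
set (t := Rmin d T / 2).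
assert (Ht : 0 < t /\ t < d /\ t < T).
{ pose proof (cond_pos d). unfold t, Rmin. destruct Rle_dec; lra. }
specialize (Hdel t). rewrite Rplus_0_l, H0, Rminus_0_r in Hdel.
assert (K : Rabs (f t / t - v) < - v).
{ apply Hdel; [lra|]. rewrite Rabs_pos_eq; lra. }
apply Rabs_def2 in K.
assert (0 < f t / t) by (apply Rdiv_lt_0_compat; [apply Hp; lra|lra]).
lra.
Qed.

Lemma is_derive_line_form (x y : R -> R) (c mu t a b dx dy : R) (W : R * R) :
  is_derive x t dx -> is_derive y t dy ->
  is_derive (fun s => c * (mu * ((x s - a) * snd W - (y s - b) * fst W))) t
    (c * (mu * (dx * snd W - dy * fst W))).
Proof.
intros Dx Dy.
assert (Ex : ex_derive x t) by (now exists dx).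
assert (Ey : ex_derive y t) by (now exists dy).
auto_derive; [tauto|].
rewrite (is_derive_unique (fun s : R => x s) _ _ Dx),
        (is_derive_unique (fun s : R => y s) _ _ Dy). ring.
Qed.

Lemma first_integral_section (U : R * R -> Prop) (F : R * R -> R * R)
    (p0 W : R * R) (H M : R * R -> R) (g kappa : R) :
  (forall s, 0 < s -> U (section_point p0 W s)) ->
  first_integral U F H M ->
  (forall s, 0 < s ->
     M (section_point p0 W s) * cross (F (section_point p0 W s)) W
     = kappa * (Rpower s (g - 1) * (s - 1))) ->
  forall r s, 0 < r -> 0 < s ->
  H (section_point p0 W s) - H (section_point p0 W r)
  = kappa * (section_potential g s - section_potential g r).
Proof.
intros HU [_ HH] Hk.
assert (D : forall s, 0 < s ->
  is_derive (fun s => H (section_point p0 W s) - kappa * section_potential g s)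
    s 0).
{ intros s Hs.
  assert (D1 : is_derive (fun s => H (section_point p0 W s)) s
            (kappa * (Rpower s (g - 1) * (s - 1)))).
  { rewrite <- (Hk s Hs). rewrite (surjective_pairing W) at 3.
    apply (HH (fun s => fst p0 + (s - 1) * fst W)
              (fun s => snd p0 + (s - 1) * snd W)).
    - now apply HU.
    - auto_derive; [exact I|ring].
    - auto_derive; [exact I|ring]. }
  pose proof (is_derive_scal _ s kappa _ (is_derive_section_potential g s Hs))
    as D2.
  pose proof (is_derive_minus _ _ _ _ _ D1 D2) as D3.
  match type of D3 with is_derive _ _ ?l => replace 0 with l; [exact D3|] end.
  unfold minus, plus, opp; simpl. ring. }
assert (K : forall r s, 0 < r -> r <= s ->
  H (section_point p0 W s) - H (section_point p0 W r)
  = kappa * (section_potential g s - section_potential g r)).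
{ intros r s Hr Hrs.
  pose proof (is_derive_0_eq _ r s Hrs (fun x Hx => D x ltac:(lra))) as E.
  simpl in E. lra. }
intros r s Hr Hs. destruct (Rle_dec r s) as [Hrs|Hrs]; [now apply K|].
pose proof (K s r Hs ltac:(lra)). lra.
Qed.

(** Both ends of a half-return lie on one level of H, hence on one level of the
    potential.  They are distinct: the vanishing of the normal component of the
    field at a point of the section means s = 1. *)
Lemma half_return_section (U : R * R -> Prop) (F : R * R -> R * R)
    (h : R * R -> R) (p0 W : R * R) (mu g : R) (i : nat) (s : R) (q : R * R) :
  section_frame U h p0 W mu -> power_section U F p0 W g ->
  0 < s -> half_return F h i (section_point p0 W s) q ->
  exists r, 0 < r /\ q = section_point p0 W r /\
    section_potential g r = section_potential g s /\ (s <> 1 -> r <> s).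
Proof.
intros (_ & HU & HW & Hmu & Hh) (_ & Hinv & H & M & kappa & HH & Hk & Hsec)
  Hs (_ & Hq & T & ga & HT & Htr & G0 & GT & Hz).
pose proof Hq as Hq'. rewrite Hh in Hq'. apply Rmult_integral in Hq'.
destruct Hq' as [Hq'|Hq']; [now contradict Hmu|].
apply (cross_0_section_point p0 W q HW) in Hq'.
set (r := 1 + _) in Hq'. clearbody r.
assert (HUt : forall t, 0 <= t <= T -> U (ga t)).
{ apply Hinv; [exact Htr|]. rewrite G0. now apply HU. }
assert (Hr : 0 < r).
{ apply HU. rewrite <- Hq', <- GT. apply HUt. lra. }
exists r. split; [exact Hr|]. split; [exact Hq'|].
assert (Hconst : H (ga 0) = H (ga T)).
{ apply (is_derive_0_eq (fun t => H (ga t))); [lra|]. intros t Ht.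
  destruct (Htr t Ht) as [D1 D2]. destruct HH as [_ HH].
  pose proof (HH (fun t => fst (ga t)) (fun t => snd (ga t)) t
    (fst (F (ga t))) (snd (F (ga t)))) as D.
  cbv beta in D. rewrite <- surjective_pairing in D.
  specialize (D (HUt t Ht) D1 D2).
  apply (is_derive_ext _ (fun t => H (ga t))) in D.
  2: { intros v. now rewrite <- surjective_pairing. }
  match type of D with is_derive _ _ ?l => replace 0 with l; [exact D|] end.
  unfold cross; simpl. ring. }
split.
- rewrite G0, GT, Hq' in Hconst.
  pose proof (first_integral_section U F p0 W H M g kappa
    (fun v Hv => proj2 (HU v) Hv) HH Hsec s r Hs Hr) as E.
  rewrite Hconst, Rminus_diag in E.
  symmetry in E. apply Rmult_integral in E. destruct E as [E|E]; lra.
- (* An orbit that comes back to its starting point while staying on one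
     side of the line is tangent to the line there. *)
  intros Hs1 ->. rewrite Hq' in Hq, GT. clear q Hq'.
  set (v := (-1) ^ i * (mu * cross (F (section_point p0 W s)) W)).
  assert (Dt : forall t, 0 <= t <= T -> ga t = section_point p0 W s ->
            is_derive (fun t => (-1) ^ i * h (ga t)) t v).
  { intros t Ht E. destruct (Htr t Ht) as [D1 D2].
    apply (is_derive_ext (fun t => (-1) ^ i * (mu *
      ((fst (ga t) - fst p0) * snd W - (snd (ga t) - snd p0) * fst W)))).
    - intros z. rewrite Hh. unfold cross; simpl. reflexivity.
    - unfold v. rewrite <- E.
      apply (is_derive_line_form (fun t => fst (ga t)) (fun t => snd (ga t)));
        [exact D1|exact D2]. }
  assert (Hz0 : forall t, ga t = section_point p0 W s ->
            (-1) ^ i * h (ga t) = 0).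
  { intros t ->. rewrite Hq. ring. }
  assert (V1 : 0 <= v).
  { apply (right_derivative_ge0 (fun t => (-1) ^ i * h (ga t)) T);
      [exact HT|now apply Hz0|exact Hz|apply Dt; [lra|exact G0]]. }
  assert (V2 : 0 <= - v).
  { apply (right_derivative_ge0 (fun t => (-1) ^ i * h (ga (T - t))) T);
      [exact HT| | |].
    - apply Hz0. now rewrite Rminus_0_r.
    - intros t Ht. apply Hz. lra.
    - assert (Dm : is_derive (fun t => T - t) 0 (-1)).
      { auto_derive; [exact I|ring]. }
      assert (DT : is_derive (fun t => (-1) ^ i * h (ga t)) (T - 0) v).
      { rewrite Rminus_0_r. apply Dt; [lra|exact GT]. }
      pose proof (is_derive_comp _ (fun t => T - t) 0 _ _ DT Dm) as D.
      replace (- v) with (scal (-1) v); [exact D|].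
      unfold scal; simpl; unfold mult; simpl. ring. }
  assert (V0 : v = 0) by lra. unfold v in V0.
  specialize (Hsec s Hs).
  assert (C0 : cross (F (section_point p0 W s)) W = 0).
  { apply Rmult_integral in V0. destruct V0 as [V0|V0].
    - exfalso. revert V0. apply pow_nonzero. lra.
    - apply Rmult_integral in V0. tauto. }
  rewrite C0, Rmult_0_r in Hsec. symmetry in Hsec.
  apply Rmult_integral in Hsec. destruct Hsec as [E|E]; [now apply Hk|].
  apply Rmult_integral in E. destruct E as [E|E]; [|lra].
  pose proof (Rpower_pos s (g - 1)). lra.
Qed.

Lemma pow_m1_sqr (i : nat) : (-1) ^ i * (-1) ^ i = 1.
Proof. rewrite <- Rpow_mult_distr. replace (-1 * -1) with 1 by ring. apply pow1. Qed.

(** The side condition on s selects the half-line on which orbits enter zone i.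
    The frame of the half-turn is scaled by (-1)^i, sg and mu: n must point into zone i
    and (w, n) must be oriented like the rotation, which leaves no choice for
    the sign of w. *)
Lemma half_return_exists (U : R * R -> Prop) (F : R * R -> R * R)
    (h : R * R -> R) (p0 W : R * R) (mu g sg : R) (i : nat) :
  section_frame U h p0 W mu -> power_section U F p0 W g ->
  sg <> 0 -> locally' p0 (fun p => 0 < sg * angular F p0 p) ->
  forall rad, 0 < rad ->
  exists eta, 0 < eta /\ forall s, Rabs (s - 1) < eta ->
    0 < - (-1) ^ i * sg * mu * (s - 1) ->
    exists r, half_return F h i (section_point p0 W s) (section_point p0 W r)
      /\ (r - 1) * (s - 1) < 0 /\ Rabs (r - 1) < rad.
Proof.
intros (HUl & HU & HW & Hmu & Hh) (Hcont & _ & H & M & kappa & HH & _)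
  Hsg [e1 Hang] rad Hrad.
destruct HUl as [e2 HUl].
set (eps := Rmin e1 e2).
assert (Heps : 0 < eps) by (apply Rmin_pos; apply cond_pos).
assert (He1 : eps <= e1) by apply Rmin_l.
assert (He2 : eps <= e2) by apply Rmin_r.
assert (HUb : forall p, ball p0 eps p -> U p).
{ intros p Hp. apply HUl. now apply ball_le with eps. }
set (c := - (-1) ^ i * sg * mu).
pose proof (pow_m1_sqr i) as Hi.
assert (Hc : c <> 0).
{ unfold c. repeat apply Rmult_integral_contrapositive_currified;
    try assumption. nra. }
assert (Hca : 0 < Rabs c) by now apply Rabs_pos_lt.
pose proof (sum_sqr_pos W HW) as HN.
set (w := (c * fst W, c * snd W)).
set (n := (- (-1) ^ i * mu * - snd W, - (-1) ^ i * mu * fst W)).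
destruct (half_turn F p0 w n H M sg eps) with (rad := rad / Rabs c)
  as [eta [Heta Hturn]].
- exact Heps.
- destruct HH as [HM HH]. split.
  + intros p Hp. apply HM, HUb, Hp.
  + intros x y t dx dy Hp. apply HH, HUb, Hp.
- intros p Hp. apply Hcont, HUb, Hp.
- intros p Hp Hne. apply Hang; [now apply ball_le with eps|exact Hne].
- unfold cross, w, n, c; simpl.
  replace (sg * _) with
    (((-1) ^ i * (-1) ^ i) * (sg * mu) ^ 2 * (fst W ^ 2 + snd W ^ 2)) by ring.
  rewrite Hi, Rmult_1_l. apply Rmult_lt_0_compat; [|exact HN].
  apply pow2_gt_0. now apply Rmult_integral_contrapositive_currified.
- now apply Rdiv_lt_0_compat.
- exists (eta * Rabs c). split; [now apply Rmult_lt_0_compat|].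
  intros s Hs Hside. fold c in Hside.
  set (tau := (s - 1) / c).
  assert (Etau : s - 1 = tau * c) by (unfold tau; field; exact Hc).
  assert (Htau0 : 0 < tau).
  { rewrite Etau in Hside. assert (0 < c ^ 2) by now apply pow2_gt_0. nra. }
  assert (Htau1 : tau < eta).
  { rewrite Etau, Rabs_mult, (Rabs_pos_eq tau) in Hs by lra.
    now apply Rmult_lt_reg_r with (Rabs c). }
  destruct (Hturn tau (conj Htau0 Htau1))
    as (tau' & T & ga & Htau' & HT & Htr & G0 & GT & Hin).
  assert (E0 : polar p0 w n 0 tau = section_point p0 W s).
  { unfold polar, section_point, w, n; simpl.
    rewrite cos_0, sin_0, Etau. f_equal; ring. }
  assert (E1 : polar p0 w n PI tau' = section_point p0 W (1 - tau' * c)).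
  { unfold polar, section_point, w, n; simpl.
    rewrite cos_PI, sin_PI. f_equal; ring. }
  assert (Hline : forall s, h (section_point p0 W s) = 0).
  { intros v. rewrite Hh. unfold cross, section_point; simpl. ring. }
  exists (1 - tau' * c). split; [|split].
  + split; [apply Hline|split; [apply Hline|]].
    exists T, ga. split; [exact HT|]. split; [exact Htr|].
    split; [now rewrite G0|]. split; [now rewrite GT|].
    intros t Ht. destruct (Hin t Ht) as (rho & th & Hrho & Hth & ->).
    unfold zone. rewrite Hh. unfold polar, cross, w, n; simpl.
    replace ((-1) ^ i * _) with
      (((-1) ^ i * (-1) ^ i) * mu ^ 2 * (rho * sin th)
       * (fst W ^ 2 + snd W ^ 2)) by ring.
    rewrite Hi, Rmult_1_l.
    assert (0 < sin th) by (apply sin_gt_0; lra).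
    apply Rmult_lt_0_compat; [|exact HN].
    apply Rmult_lt_0_compat; [now apply pow2_gt_0|].
    now apply Rmult_lt_0_compat.
  + rewrite Etau. assert (0 < c ^ 2) by now apply pow2_gt_0.
    replace ((1 - tau' * c - 1) * (tau * c)) with
      (- (tau' * tau * c ^ 2)) by ring.
    assert (0 < tau' * tau * c ^ 2).
    { apply Rmult_lt_0_compat; [apply Rmult_lt_0_compat; lra|assumption]. }
    lra.
  + replace (1 - tau' * c - 1) with (- (tau' * c)) by ring.
    rewrite Rabs_Ropp, Rabs_mult, (Rabs_pos_eq tau') by lra.
    replace rad with (rad / Rabs c * Rabs c) by (field; lra).
    apply Rmult_lt_compat_r; lra.
Qed.

(** After two half-returns the orbit is on its initial half-line and on its
    initial level of the potential, hence at its initial point. *)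
Lemma orbits_close (U : R * R -> Prop) (F F' : R * R -> R * R)
    (h : R * R -> R) (p0 W : R * R) (mu g sg : R) (i j : nat) :
  section_frame U h p0 W mu ->
  power_section U F p0 W g -> power_section U F' p0 W g ->
  sg <> 0 ->
  locally' p0 (fun p => 0 < sg * angular F p0 p) ->
  locally' p0 (fun p => 0 < sg * angular F' p0 p) ->
  (-1) ^ j = - (-1) ^ i ->
  exists eta, 0 < eta /\ forall s, Rabs (s - 1) < eta ->
    0 < - (-1) ^ i * sg * mu * (s - 1) ->
    exists r, half_return F h i (section_point p0 W s) r /\
              half_return F' h j r (section_point p0 W s).
Proof.
intros HS HF HF' Hsg Ha Ha' Hij.
destruct (half_return_exists U F' h p0 W mu g sg j HS HF' Hsg Ha' 1 Rlt_0_1)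
  as [eta' [Heta' H2]].
destruct (half_return_exists U F h p0 W mu g sg i HS HF Hsg Ha eta' Heta')
  as [eta [Heta H1]].
exists (Rmin eta 1). split; [apply Rmin_pos; lra|].
intros s Hs Hside.
assert (Hs1 : Rabs (s - 1) < eta) by (eapply Rlt_le_trans; [exact Hs|apply Rmin_l]).
assert (Hs2 : Rabs (s - 1) < 1) by (eapply Rlt_le_trans; [exact Hs|apply Rmin_r]).
assert (Hs0 : 0 < s) by (apply Rabs_def2 in Hs2; lra).
destruct (H1 s Hs1 Hside) as [r [Hret [Hopp Hr]]].
exists (section_point p0 W r). split; [exact Hret|].
assert (Hside' : 0 < - (-1) ^ j * sg * mu * (r - 1)).
{ rewrite Hij. assert (s - 1 <> 0) by (intros E; rewrite E in Hopp; lra).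
  assert (0 < (s - 1) ^ 2) by now apply pow2_gt_0.
  set (k := (-1) ^ i * sg * mu) in *.
  replace (- (-1) ^ i * sg * mu * (s - 1)) with (- k * (s - 1)) in Hside
    by (unfold k; ring).
  replace (- - (-1) ^ i * sg * mu * (r - 1)) with (k * (r - 1))
    by (unfold k; ring).
  nra. }
destruct (H2 r Hr Hside') as [s' [Hret' [Hopp' Hs']]].
destruct (half_return_section U F h p0 W mu g i s _ HS HF Hs0 Hret)
  as (r1 & Hr1 & Er1 & Pr1 & _).
pose proof HS as (_ & _ & HW & _).
apply (section_point_inj _ _ _ _ HW) in Er1. subst r1.
destruct (half_return_section U F' h p0 W mu g j r _ HS HF' Hr1 Hret')
  as (s1 & Hs1' & Es1 & Ps1 & _).
apply (section_point_inj _ _ _ _ HW) in Es1. subst s1.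
assert (s' = s).
{ apply (section_potential_inj g); try assumption; [|congruence].
  apply Rnot_lt_le. intros Hneg.
  pose proof (Rmult_lt_gt_compat_neg_l _ _ _ Hopp Hopp') as K.
  pose proof (Rmult_le_compat_neg_l _ _ _ (Rlt_le _ _ Hneg) (pow2_ge_0 (r - 1))).
  lra. }
now subst s'.
Qed.

Lemma locally'_section (p0 W : R * R) (P : R * R -> Prop) :
  W <> (0, 0) ->
  (exists eta, 0 < eta /\ forall s, Rabs (s - 1) < eta -> s <> 1 ->
     P (section_point p0 W s)) ->
  locally' p0 (fun p => cross (fst p - fst p0, snd p - snd p0) W = 0 -> P p).
Proof.
intros HW [eta [Heta HP]].
pose proof (sum_sqr_pos W HW) as HN.
set (N := fst W ^ 2 + snd W ^ 2) in *.
set (K := Rabs (fst W) + Rabs (snd W) + 1).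
assert (HK : 0 < K).
{ unfold K. pose proof (Rabs_pos (fst W)). pose proof (Rabs_pos (snd W)). lra. }
set (q := eta * N / K).
assert (Hd : 0 < q).
{ apply Rdiv_lt_0_compat; [now apply Rmult_lt_0_compat|exact HK]. }
assert (Hq : eta * N = q * K) by (unfold q; field; lra).
clearbody q.
exists (mkposreal _ Hd). intros p [B1 B2] Hne Hc.
change (Rabs (fst p - fst p0) < q) in B1.
change (Rabs (snd p - snd p0) < q) in B2.
apply (cross_0_section_point p0 W p HW) in Hc.
destruct p as [px py]. cbn [fst snd] in B1, B2, Hc. fold N in Hc.
match type of Hc with _ = section_point _ _ (1 + ?e / _) =>
  set (z := e) in Hc end.
assert (Hz : Rabs z < eta * N).
{ rewrite Hq. unfold z. eapply Rle_lt_trans; [apply Rabs_triang|]. rewrite !Rabs_mult.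
  pose proof (Rmult_le_compat_r _ _ _ (Rabs_pos (fst W)) (Rlt_le _ _ B1)).
  pose proof (Rmult_le_compat_r _ _ _ (Rabs_pos (snd W)) (Rlt_le _ _ B2)).
  unfold K. lra. }
clearbody z. rewrite Hc. apply HP.
- replace (1 + z / N - 1) with (z / N) by ring.
  unfold Rdiv. rewrite Rabs_mult, (Rabs_pos_eq (/ N)).
  2: { left. now apply Rinv_0_lt_compat. }
  apply Rmult_lt_reg_r with N; [exact HN|].
  rewrite Rmult_assoc, Rinv_l by lra. lra.
- intros E. apply Hne. rewrite Hc, E. unfold section_point.
  rewrite (surjective_pairing p0) at 3. f_equal; ring.
Qed.

Lemma locally'_section_nonempty (p0 W : R * R) (P : R * R -> Prop) :
  W <> (0, 0) -> locally' p0 P ->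
  exists s, 1 < s /\ P (section_point p0 W s).
Proof.
intros HW [eps HP].
set (K := Rabs (fst W) + Rabs (snd W) + 1).
assert (HK : 1 <= K /\ Rabs (fst W) < K /\ Rabs (snd W) < K).
{ unfold K. pose proof (Rabs_pos (fst W)). pose proof (Rabs_pos (snd W)). lra. }
set (d := eps / K).
assert (Hd : 0 < d) by (apply Rdiv_lt_0_compat; [apply cond_pos|lra]).
assert (Ed : d * K = eps) by (unfold d; field; lra).
exists (1 + d). split; [lra|]. apply HP.
- split.
  + change (Rabs (fst p0 + (1 + d - 1) * fst W - fst p0) < eps).
    replace (fst p0 + (1 + d - 1) * fst W - fst p0) with (d * fst W) by ring.
    rewrite Rabs_mult, (Rabs_pos_eq d) by lra. nra.
  + change (Rabs (snd p0 + (1 + d - 1) * snd W - snd p0) < eps).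
    replace (snd p0 + (1 + d - 1) * snd W - snd p0) with (d * snd W) by ring.
    rewrite Rabs_mult, (Rabs_pos_eq d) by lra. nra.
- intros E. pose proof (sum_sqr_pos W HW) as HN.
  pose proof (f_equal fst E) as X1. pose proof (f_equal snd E) as X2.
  unfold section_point in X1, X2; simpl in X1, X2.
  assert (fst W = 0) as W1 by nra. assert (snd W = 0) as W2 by nra.
  rewrite W1, W2 in HN. lra.
Qed.

(** For the direct implication one orbit near p0 is enough; the three crossing
    values s, r, s form a pair identified by both potentials. *)
Theorem has_center_iff_exponents (U : R * R -> Prop) (F1 F2 : R * R -> R * R)
    (h : R * R -> R) (p0 W : R * R) (mu g1 g2 : R) :
  section_frame U h p0 W mu ->
  power_section U F1 p0 W g1 -> power_section U F2 p0 W g2 ->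
  monodromic F1 F2 p0 ->
  has_center F1 F2 h p0 <-> g1 = g2.
Proof.
intros HS H1 H2 Hmono. pose proof HS as (_ & _ & HW & Hmu & Hh). split.
- intros Hc.
  destruct (locally'_section_nonempty p0 W _ HW Hc) as [s [Hs Hret]].
  assert (Hs0 : 0 < s) by lra.
  destruct Hret as [q [[R1 R2]|[R2 R1]]].
  + rewrite Hh. unfold cross, section_point; simpl. ring.
  + destruct (half_return_section U F1 h p0 W mu g1 1 s q HS H1 Hs0 R1)
      as (r & Hr & -> & E1 & Hne).
    destruct (half_return_section U F2 h p0 W mu g2 2 r _ HS H2 Hr R2)
      as (s' & Hs' & Es & E2 & _).
    apply (section_point_inj _ _ _ _ HW) in Es. subst s'.
    apply (section_potential_exponent g1 g2 r s Hr Hs0);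
      [apply Hne; lra|exact E1|now symmetry].
  + destruct (half_return_section U F2 h p0 W mu g2 2 s q HS H2 Hs0 R2)
      as (r & Hr & -> & E2 & Hne).
    destruct (half_return_section U F1 h p0 W mu g1 1 r _ HS H1 Hr R1)
      as (s' & Hs' & Es & E1 & _).
    apply (section_point_inj _ _ _ _ HW) in Es. subst s'.
    apply (section_potential_exponent g1 g2 r s Hr Hs0);
      [apply Hne; lra|now symmetry|exact E2].
- intros <-.
  assert (Hsg : exists sg, sg <> 0 /\
    locally' p0 (fun p => 0 < sg * angular F1 p0 p) /\
    locally' p0 (fun p => 0 < sg * angular F2 p0 p)).
  { destruct Hmono as [[A1 A2]|[A1 A2]];
      unfold rotates_ccw, rotates_cw in A1, A2.
    - exists 1. split; [lra|]. split.
      + revert A1. apply filter_imp. intros p. lra.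
      + revert A2. apply filter_imp. intros p. lra.
    - exists (-1). split; [lra|]. split.
      + revert A1. apply filter_imp. intros p. lra.
      + revert A2. apply filter_imp. intros p. lra. }
  destruct Hsg as (sg & Hsg & A1 & A2).
  destruct (orbits_close U F1 F2 h p0 W mu g1 sg 1 2 HS H1 H2 Hsg A1 A2)
    as [eta1 [Heta1 C1]]; [ring|].
  destruct (orbits_close U F2 F1 h p0 W mu g1 sg 2 1 HS H2 H1 Hsg A2 A1)
    as [eta2 [Heta2 C2]]; [ring|].
  assert (L : locally' p0 (fun p =>
            cross (fst p - fst p0, snd p - snd p0) W = 0 ->
            return_map F1 F2 h p p)).
  { apply locally'_section; [exact HW|].
    exists (Rmin eta1 eta2). split; [now apply Rmin_pos|]. intros s Hs Hs1.
    assert (K1 : Rabs (s - 1) < eta1)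
      by (eapply Rlt_le_trans; [exact Hs|apply Rmin_l]).
    assert (K2 : Rabs (s - 1) < eta2)
      by (eapply Rlt_le_trans; [exact Hs|apply Rmin_r]).
    assert (Hk : sg * mu * (s - 1) <> 0).
    { repeat apply Rmult_integral_contrapositive_currified; try assumption.
      lra. }
    destruct (Rdichotomy _ _ Hk) as [Hneg|Hpos].
    - destruct (C2 s K2) as [r [R1 R2]]; [simpl; lra|].
      exists r. right. now split.
    - destruct (C1 s K1) as [r [R1 R2]]; [simpl; lra|].
      exists r. left. now split. }
  unfold has_center. revert L. apply filter_imp. intros p Hp Hhp. apply Hp.
  rewrite Hh in Hhp. apply Rmult_integral in Hhp. tauto.
Qed.

(** * Kolmogorov systems with a trace-zero equilibrium *)

(** If m bounds q from below, then z^2 exp (- 2 m t) is nondecreasing, so z never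
    vanishes. *)
Lemma linear_equation_pos (z q : R -> R) (T : R) :
  (forall t, 0 <= t <= T -> is_derive z t (z t * q t)) ->
  (forall t, 0 <= t <= T -> continuity_pt q t) ->
  0 < z 0 -> forall t, 0 <= t <= T -> 0 < z t.
Proof.
intros Hz Hq H0 t Ht.
destruct (continuity_ab_min q 0 T) as [tm [Hm _]]; [lra|exact Hq|].
set (m := q tm) in *. clearbody m.
assert (Hcont : forall v, 0 <= v <= T -> continuity_pt z v).
{ intros v Hv. apply continuity_pt_filterlim.
  apply (ex_derive_continuous z). eexists. now apply Hz. }
assert (Hne : forall v, 0 <= v <= T -> z v <> 0).
{ intros v Hv E.
  destruct (Req_dec v 0) as [->|Hv0]; [lra|].
  destruct (MVT_cor2 (fun s => z s * z s * exp (- (2 * m * s)))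
    (fun s => 2 * (z s * z s) * (q s - m) * exp (- (2 * m * s))) 0 v)
    as [s [Hs1 Hs2]].
  - lra.
  - intros s Hs. apply is_derive_Reals.
    assert (Ds : is_derive z s (z s * q s)) by (apply Hz; lra).
    assert (Es : ex_derive z s) by (eexists; exact Ds).
    auto_derive; [tauto|].
    rewrite (is_derive_unique (fun s : R => z s) _ _ Ds). ring.
  - replace (2 * m * 0) with 0 in Hs1 by ring.
    rewrite E, Ropp_0, exp_0 in Hs1.
    assert (0 <= 2 * (z s * z s) * (q s - m) * exp (- (2 * m * s)) * (v - 0)).
    { specialize (Hm s ltac:(lra)).
      apply Rmult_le_pos; [|lra].
      apply Rmult_le_pos; [|left; apply exp_pos].
      apply Rmult_le_pos; [nra|lra]. }
    nra. }
apply Rnot_le_lt. intros Hle.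
assert (Hlt : z t < 0).
{ destruct Hle as [L|L]; [exact L|]. now apply Hne in L. }
assert (Ht0 : 0 < t).
{ destruct (Req_dec t 0) as [->|]; lra. }
destruct (Ranalysis5.IVT_interv (fun s => - z s) 0 t) as [v [Hv E]]; try lra.
- intros v Hv. apply continuity_pt_opp, Hcont. lra.
- apply (Hne v); lra.
Qed.

Definition quadrant (x0 y0 : R) (p : R * R) : Prop :=
  0 < fst p / x0 /\ 0 < snd p / y0.

Lemma kolmogorov_continuous (U : R * R -> Prop) (a b c d e f : R) :
  continuous_field U (kolmogorov a b c d e f).
Proof.
intros p _. split.
- apply (continuous_ext
    (fun q : R * R => fst q * (a + b * fst q + c * snd q)));
    [now intros [x y]|]. continuity2.
- apply (continuous_ext
    (fun q : R * R => snd q * (d + e * fst q + f * snd q)));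
    [now intros [x y]|]. continuity2.
Qed.

Lemma kolmogorov_invariant (x0 y0 a b c d e f : R) :
  invariant (quadrant x0 y0) (kolmogorov a b c d e f).
Proof.
intros T g Htr [H1 H2] t Ht.
assert (Hder : forall t, 0 <= t <= T ->
  is_derive (fun s => fst (g s)) t
    (fst (g t) * (a + b * fst (g t) + c * snd (g t))) /\
  is_derive (fun s => snd (g s)) t
    (snd (g t) * (d + e * fst (g t) + f * snd (g t)))).
{ intros v Hv. specialize (Htr v Hv). now destruct (g v). }
assert (Hcont : forall t, 0 <= t <= T ->
  continuity_pt (fun s => fst (g s)) t /\ continuity_pt (fun s => snd (g s)) t).
{ intros v Hv. destruct (Hder v Hv) as [D1 D2]. split;
    apply continuity_pt_filterlim.
  - apply (ex_derive_continuous (fun s => fst (g s))). eexists; exact D1.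
  - apply (ex_derive_continuous (fun s => snd (g s))). eexists; exact D2. }
assert (Haff : forall k l m t, 0 <= t <= T ->
  continuity_pt (fun s => k + l * fst (g s) + m * snd (g s)) t).
{ intros k l m v Hv. destruct (Hcont v Hv) as [C1 C2].
  apply (continuity_pt_plus (fun s => k + l * fst (g s))
                            (fun s => m * snd (g s))).
  - apply (continuity_pt_plus (fun s => k) (fun s => l * fst (g s))).
    + apply continuity_pt_const. now intros ? ?.
    + now apply (continuity_pt_scal (fun s => fst (g s))).
  - now apply (continuity_pt_scal (fun s => snd (g s))). }
assert (Hscal : forall (z : R -> R) k v l, is_derive z v (z v * l) ->
  is_derive (fun s => z s / k) v (z v / k * l)).
{ intros z k v l D.
  replace (z v / k * l) with (/ k * (z v * l)) by (unfold Rdiv; ring).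
  apply (is_derive_ext (fun s => / k * z s));
    [intros s; unfold Rdiv; apply Rmult_comm|].
  now apply (is_derive_scal z). }
split.
- apply (linear_equation_pos (fun s => fst (g s) / x0)
    (fun s => a + b * fst (g s) + c * snd (g s)) T); try assumption.
  + intros v Hv. apply (Hscal (fun s => fst (g s))). now apply Hder.
  + intros v Hv. now apply Haff.
- apply (linear_equation_pos (fun s => snd (g s) / y0)
    (fun s => d + e * fst (g s) + f * snd (g s)) T); try assumption.
  + intros v Hv. apply (Hscal (fun s => snd (g s))). now apply Hder.
  + intros v Hv. now apply Haff.
Qed.

(** The line integral of M (X' dY - Y' dX) from (1, 1), first along Y = 1 and then
    along a vertical line, for X' = X (B (X-1) + C (Y-1)),
    Y' = Y (E (X-1) - B (Y-1)) and M = X^(al-1) Y^(be-1). *)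
Definition LV_integral (B C E al be X Y : R) : R :=
  - E * section_potential al X
  + Rpower X al * ((B * (X - 1) - C) * power_primitive (be - 1) Y
                   + C * power_primitive be Y).

Lemma is_derive_LV_form (x u1 u2 u3 u4 : R -> R) (B C E t dx d1 d2 d3 d4 : R) :
  is_derive x t dx -> is_derive u1 t d1 -> is_derive u2 t d2 ->
  is_derive u3 t d3 -> is_derive u4 t d4 ->
  is_derive (fun s => - E * u1 s
      + u2 s * ((B * (x s - 1) - C) * u3 s + C * u4 s)) t
    (- E * d1 + d2 * ((B * (x t - 1) - C) * u3 t + C * u4 t)
     + u2 t * (B * dx * u3 t + (B * (x t - 1) - C) * d3 + C * d4)).
Proof.
intros D0 D1 D2 D3 D4.
assert (ex_derive x t) by (now exists dx).
assert (ex_derive u1 t) by (now exists d1).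
assert (ex_derive u2 t) by (now exists d2).
assert (ex_derive u3 t) by (now exists d3).
assert (ex_derive u4 t) by (now exists d4).
auto_derive; [tauto|].
rewrite (is_derive_unique (fun s : R => x s) _ _ D0),
  (is_derive_unique (fun s : R => u1 s) _ _ D1),
  (is_derive_unique (fun s : R => u2 s) _ _ D2),
  (is_derive_unique (fun s : R => u3 s) _ _ D3),
  (is_derive_unique (fun s : R => u4 s) _ _ D4). ring.
Qed.

(** The two relations on al and be say that M times the field is
    divergence-free, which is what makes the X-derivative right. *)
Lemma is_derive_LV_integral (B C E al be : R) (x y : R -> R) (t dx dy : R) :
  al * B + be * E + B = 0 -> al * C - be * B - B = 0 ->
  0 < x t -> 0 < y t -> is_derive x t dx -> is_derive y t dy ->
  is_derive (fun s => LV_integral B C E al be (x s) (y s)) t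
    (Rpower (x t) (al - 1) * Rpower (y t) (be - 1) *
     (x t * (B * (x t - 1) + C * (y t - 1)) * dy
      - y t * (E * (x t - 1) - B * (y t - 1)) * dx)).
Proof.
intros K1 K2 Hx Hy Dx Dy.
pose proof (is_derive_comp _ x t _ _
  (is_derive_section_potential al (x t) Hx) Dx) as D1.
pose proof (is_derive_comp _ x t _ _ (is_derive_Rpower al (x t) Hx) Dx) as D2.
pose proof (is_derive_comp _ y t _ _
  (is_derive_power_primitive (be - 1) (y t) Hy) Dy) as D3.
pose proof (is_derive_comp _ y t _ _
  (is_derive_power_primitive be (y t) Hy) Dy) as D4.
pose proof (is_derive_LV_form x _ _ _ _ B C E t _ _ _ _ _ Dx D1 D2 D3 D4) as D.
unfold LV_integral.
match type of D with is_derive _ _ ?l =>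
  match goal with |- is_derive _ _ ?l' => replace l' with l; [exact D|] end end.
unfold scal; simpl; unfold mult; simpl.
pose proof (power_primitive_eq (be - 1) (y t)) as P1.
pose proof (power_primitive_eq be (y t)) as P2.
replace (be - 1 + 1) with be in P1 by ring.
rewrite (Rpower_step (x t) al Hx).
rewrite (Rpower_step (y t) (be + 1) Hy) in P2.
replace (be + 1 - 1) with be in P2 by ring.
rewrite (Rpower_step (y t) be Hy) in P1, P2 |- *.
set (p := Rpower (x t) (al - 1)) in *. set (q := Rpower (y t) (be - 1)) in *.
set (I1 := power_primitive (be - 1) (y t)) in *.
set (I2 := power_primitive be (y t)) in *.
set (X := x t) in *. set (Y := y t) in *.
(* The primitives I1 and I2 enter only through be * I1 and (be + 1) * I2, which
   are powers of Y, once the relations on al and be are factored out. *)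
transitivity (p * q * X * (B * (X - 1) + C * (Y - 1)) * dy
  + p * dx * (- E * (X - 1) + (E - B - E * X) * (be * I1) + B * ((be + 1) * I2)
     + (al * B + be * E + B) * I1 * (X - 1)
     + (al * C - be * B - B) * (I2 - I1))); [ring|].
rewrite K1, K2, P1, P2. ring.
Qed.

Definition trace_zero_equilibrium (a b c d e f x0 y0 D : R) : Prop :=
  x0 <> 0 /\ y0 <> 0 /\ D <> 0 /\
  a + b * x0 + c * y0 = 0 /\ d + e * x0 + f * y0 = 0 /\
  b * x0 + f * y0 = 0 /\ x0 * y0 * (b * f - c * e) = D ^ 2.

(** The exponents al and be solve the two equations of [exponent_relations]; the
    determinant of that system is D^2. *)
Definition exponent_x (b e x0 D : R) : R :=
  b * x0 * (b * x0 - e * x0) / D ^ 2.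
Definition exponent_y (b c x0 y0 D : R) : R :=
  b * x0 * (b * x0 + c * y0) / D ^ 2.

Section Kolmogorov.

Variables a b c d e f x0 y0 D : R.
Hypothesis Heq : trace_zero_equilibrium a b c d e f x0 y0 D.

Let al := exponent_x b e x0 D.
Let be := exponent_y b c x0 y0 D.

(** Since c e is determined by b and D, the y-coefficients can be eliminated
    from the exponents, as the center conditions require. *)
Lemma det_scaled : c * y0 * (e * x0) = - (b * x0) ^ 2 - D ^ 2.
Proof.
destruct Heq as (Hx & Hy & HD & Ha & Hd & Ht & Hdet). rewrite <- Hdet.
transitivity (b * x0 * (f * y0) - x0 * y0 * (b * f - c * e)); [ring|].
replace (f * y0) with (- (b * x0)) by lra. ring.
Qed.

Lemma D_sqr_pos : 0 < D ^ 2.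
Proof. destruct Heq as (_ & _ & HD & _). now apply pow2_gt_0. Qed.

Lemma exponent_relations :
  al * (b * x0) + be * (e * x0) + b * x0 = 0 /\
  al * (c * y0) - be * (b * x0) - b * x0 = 0.
Proof.
pose proof det_scaled as E. pose proof D_sqr_pos as HD.
unfold al, be, exponent_x, exponent_y.
set (B := b * x0) in *. set (C := c * y0) in *. set (F := e * x0) in *.
split; apply Rmult_eq_reg_r with (D ^ 2); try lra.
- transitivity (B * (C * F + B ^ 2 + D ^ 2)); [field; nra|]. rewrite E. ring.
- transitivity (- B * (C * F + B ^ 2 + D ^ 2)); [field; nra|]. rewrite E. ring.
Qed.

Definition kolmogorov_integral (p : R * R) : R :=
  x0 * y0 * LV_integral (b * x0) (c * y0) (e * x0) al be
              (fst p / x0) (snd p / y0).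

Definition integrating_factor (p : R * R) : R :=
  Rpower (fst p / x0) (al - 1) * Rpower (snd p / y0) (be - 1).

Lemma kolmogorov_first_integral :
  first_integral (quadrant x0 y0) (kolmogorov a b c d e f)
    kolmogorov_integral integrating_factor.
Proof.
destruct Heq as (Hx & Hy & HD & Ha & Hd & Ht & Hdet).
destruct exponent_relations as [K1 K2]. split.
- intros p _. apply Rmult_lt_0_compat; apply Rpower_pos.
- intros x y t dx dy [HX HY] Dx Dy. simpl in HX, HY.
  assert (DX : is_derive (fun s => x s / x0) t (dx / x0)).
  { apply (is_derive_ext (fun s => / x0 * x s));
      [intros s; unfold Rdiv; apply Rmult_comm|].
    replace (dx / x0) with (/ x0 * dx) by (unfold Rdiv; apply Rmult_comm).
    now apply is_derive_scal. }
  assert (DY : is_derive (fun s => y s / y0) t (dy / y0)).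
  { apply (is_derive_ext (fun s => / y0 * y s));
      [intros s; unfold Rdiv; apply Rmult_comm|].
    replace (dy / y0) with (/ y0 * dy) by (unfold Rdiv; apply Rmult_comm).
    now apply is_derive_scal. }
  pose proof (is_derive_LV_integral (b * x0) (c * y0) (e * x0) al be
    (fun s => x s / x0) (fun s => y s / y0) t _ _ K1 K2 HX HY DX DY) as D0.
  apply (is_derive_scal _ _ (x0 * y0)) in D0.
  unfold kolmogorov_integral, integrating_factor; simpl.
  match type of D0 with is_derive _ _ ?l =>
    match goal with |- is_derive _ _ ?l' =>
      replace l' with l; [exact D0|] end end.
  unfold cross; simpl.
  replace a with (- (b * x0) - c * y0) by lra.
  replace d with (- (e * x0) - f * y0) by lra.
  replace f with (- (b * x0) / y0) by (field_simplify_eq; lra).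
  set (p := Rpower _ _). set (q := Rpower (y t / y0) _). field. now split.
Qed.

Lemma kolmogorov_power_section (W : R * R) (g kappa : R) :
  kappa <> 0 ->
  (forall s, 0 < s ->
     integrating_factor (section_point (x0, y0) W s)
     * cross (kolmogorov a b c d e f (section_point (x0, y0) W s)) W
     = kappa * (Rpower s (g - 1) * (s - 1))) ->
  power_section (quadrant x0 y0) (kolmogorov a b c d e f) (x0, y0) W g.
Proof.
intros Hk Hs. split; [apply kolmogorov_continuous|].
split; [apply kolmogorov_invariant|].
exists kolmogorov_integral, integrating_factor, kappa.
split; [apply kolmogorov_first_integral|]. now split.
Qed.

Lemma e_neq_0 : e <> 0.
Proof.
intros E. pose proof det_scaled as K. pose proof D_sqr_pos.
rewrite E, Rmult_0_l, Rmult_0_r in K. pose proof (pow2_ge_0 (b * x0)). lra.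
Qed.

Lemma c_neq_0 : c <> 0.
Proof.
intros E. pose proof det_scaled as K. pose proof D_sqr_pos.
rewrite E, !Rmult_0_l in K. pose proof (pow2_ge_0 (b * x0)). lra.
Qed.

Lemma Rpower_1_l (z : R) : Rpower 1 z = 1.
Proof. unfold Rpower. now rewrite ln_1, Rmult_0_r, exp_0. Qed.

(** The factor kappa contains 2 B + C - E in the scaled coefficients; if it
    vanished, then [det_scaled] would give (E - B)^2 + D^2 = 0. *)
Lemma power_section_diagonal :
  power_section (quadrant x0 y0) (kolmogorov a b c d e f) (x0, y0) (x0, y0)
    (al + be).
Proof.
pose proof Heq as (Hx & Hy & HD & Ha & Hd & Ht & Hdet).
apply (kolmogorov_power_section _ _
  (x0 * y0 * (2 * (b * x0) + c * y0 - e * x0))).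
- repeat apply Rmult_integral_contrapositive_currified; try assumption.
  intros E. pose proof det_scaled as K. pose proof D_sqr_pos.
  replace (c * y0) with (e * x0 - 2 * (b * x0)) in K by lra.
  pose proof (pow2_ge_0 (b * x0 - e * x0)). nra.
- intros s Hs.
  unfold integrating_factor, section_point, cross, kolmogorov; simpl.
  replace ((x0 + (s - 1) * x0) / x0) with s by (field; assumption).
  replace ((y0 + (s - 1) * y0) / y0) with s by (field; assumption).
  replace (al + be - 1) with (al - 1 + (be - 1) + 1) by ring.
  rewrite !Rpower_plus, Rpower_1 by exact Hs.
  replace a with (- (b * x0) - c * y0) by lra.
  replace d with (- (e * x0) - f * y0) by lra.
  replace f with (- (b * x0) / y0) by (field_simplify_eq; lra).
  field. assumption.
Qed.

Lemma power_section_horizontal :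
  power_section (quadrant x0 y0) (kolmogorov a b c d e f) (x0, y0) (x0, 0) al.
Proof.
pose proof Heq as (Hx & Hy & HD & Ha & Hd & Ht & Hdet).
apply (kolmogorov_power_section _ _ (- (x0 * y0 * (e * x0)))).
- apply Ropp_neq_0_compat.
  repeat apply Rmult_integral_contrapositive_currified; try assumption.
  apply e_neq_0.
- intros s Hs.
  unfold integrating_factor, section_point, cross, kolmogorov; simpl.
  replace ((x0 + (s - 1) * x0) / x0) with s by (field; assumption).
  replace ((y0 + (s - 1) * 0) / y0) with 1 by (field; assumption).
  rewrite Rpower_1_l.
  replace d with (- (e * x0) - f * y0) by lra. ring.
Qed.

Lemma power_section_vertical :
  power_section (quadrant x0 y0) (kolmogorov a b c d e f) (x0, y0) (0, y0) be.
Proof.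
pose proof Heq as (Hx & Hy & HD & Ha & Hd & Ht & Hdet).
apply (kolmogorov_power_section _ _ (x0 * y0 * (c * y0))).
- repeat apply Rmult_integral_contrapositive_currified; try assumption.
  apply c_neq_0.
- intros s Hs.
  unfold integrating_factor, section_point, cross, kolmogorov; simpl.
  replace ((x0 + (s - 1) * 0) / x0) with 1 by (field; assumption).
  replace ((y0 + (s - 1) * y0) / y0) with s by (field; assumption).
  rewrite Rpower_1_l.
  replace a with (- (b * x0) - c * y0) by lra. ring.
Qed.

End Kolmogorov.

Lemma locally_quadrant (x0 y0 : R) :
  x0 <> 0 -> y0 <> 0 -> locally (x0, y0) (quadrant x0 y0).
Proof.
intros Hx Hy.
assert (He : 0 < Rmin (Rabs x0) (Rabs y0))
  by (apply Rmin_pos; now apply Rabs_pos_lt).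
assert (K : forall z z0, z0 <> 0 -> Rabs (z - z0) < Rabs z0 -> 0 < z / z0).
{ intros z z0 Hz0 H. destruct (Rdichotomy _ _ Hz0) as [L|L].
  - replace (z / z0) with (- z / - z0) by (field; lra).
    apply Rdiv_lt_0_compat; [|lra].
    rewrite (Rabs_left z0) in H by lra. apply Rabs_def2 in H. lra.
  - apply Rdiv_lt_0_compat; [|lra].
    rewrite (Rabs_pos_eq z0) in H by lra. apply Rabs_def2 in H. lra. }
exists (mkposreal _ He). intros p [B1 B2].
change (Rabs (fst p - x0) < Rmin (Rabs x0) (Rabs y0)) in B1.
change (Rabs (snd p - y0) < Rmin (Rabs x0) (Rabs y0)) in B2.
split; apply K; try assumption.
- eapply Rlt_le_trans; [exact B1|apply Rmin_l].
- eapply Rlt_le_trans; [exact B2|apply Rmin_r].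
Qed.

Lemma Jac_kolmogorov (a b c d e f x y : R) :
  Jac (kolmogorov a b c d e f) (x, y)
  = Mat2 (a + 2 * b * x + c * y) (c * x) (e * y) (d + e * x + 2 * f * y).
Proof.
unfold Jac, kolmogorov; simpl.
f_equal; apply is_derive_unique; auto_derive; try exact I; ring.
Qed.

(** The entry m12 does not vanish, for otherwise m22 would be a real eigenvalue.
    Then (m12, l - m11) is an eigenvector for every root l of the
    characteristic polynomial: real roots are excluded, and the real part of
    the complex ones is half the trace. *)
Lemma center_type_trace_det (A : mat2) :
  center_type A -> m11 A + m22 A = 0 /\ 0 < det2 A /\ m12 A <> 0.
Proof.
intros HA. destruct A as [p q r s]. unfold det2; simpl.
assert (Hq : q <> 0).
{ intros ->. destruct (HA (RtoC s)) as [_ Him].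
  - exists (RtoC 0), (RtoC 1). repeat split; simpl.
    + intros E. injection E. lra.
    + ring.
    + ring.
  - apply Him. reflexivity. }
(* Every complex root of the characteristic polynomial is an eigenvalue. *)
assert (Hroot : forall u v : R,
  u * u - v * v - (p + s) * u + (p * s - q * r) = 0 ->
  2 * u * v - (p + s) * v = 0 -> u = 0 /\ v <> 0).
{ intros u v E1 E2. apply (HA (u, v)).
  exists (RtoC q), ((u, v) - RtoC p)%C. repeat split; simpl.
  - intros E. injection E. intros _ _ E'. now apply Hq.
  - ring.
  - apply injective_projections; simpl; lra. }
set (dsc := (p + s) ^ 2 - 4 * (p * s - q * r)).
assert (Hd : dsc < 0).
{ apply Rnot_le_lt. intros Hd.
  pose proof (sqrt_sqrt dsc Hd) as Hs.
  destruct (Hroot ((p + s + sqrt dsc) / 2) 0) as [_ Hv]; [|ring|lra].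
  unfold dsc in *. nra. }
pose proof (sqrt_sqrt (- dsc) ltac:(lra)) as Hs.
destruct (Hroot ((p + s) / 2) (sqrt (- dsc) / 2)) as [Hu _]; [|field|].
- unfold dsc in *. nra.
- assert (Hps : p + s = 0) by lra. split; [exact Hps|]. split; [|exact Hq].
  unfold dsc in Hd. rewrite Hps in Hd. lra.
Qed.

Lemma CC_trace_zero (a b c d e f x0 y0 D : R) :
  kolmogorov a b c d e f (x0, y0) = (0, 0) ->
  center_type (Jac (kolmogorov a b c d e f) (x0, y0)) ->
  det2 (Jac (kolmogorov a b c d e f) (x0, y0)) = D ^ 2 ->
  trace_zero_equilibrium a b c d e f x0 y0 D.
Proof.
intros Heq Hct HD. destruct (center_type_trace_det _ Hct) as [Ht [Hdet Hc]].
rewrite Jac_kolmogorov in *. unfold det2 in *.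
cbn [m11 m12 m21 m22] in *.
injection Heq. intros E2 E1.
assert (Hx : x0 <> 0) by (intros ->; apply Hc; ring).
apply Rmult_integral in E1. destruct E1 as [E1|E1]; [now contradict Hx|].
assert (Hy : y0 <> 0).
{ intros ->. nra. }
apply Rmult_integral in E2. destruct E2 as [E2|E2]; [now contradict Hy|].
assert (HD0 : D <> 0) by (intros ->; lra).
repeat split; try assumption; [lra|].
rewrite <- HD.
replace (a + 2 * b * x0 + c * y0) with (b * x0) by lra.
replace (d + e * x0 + 2 * f * y0) with (f * y0) by lra. ring.
Qed.

Lemma exponent_y_eq (b c e x0 y0 D : R) :
  D <> 0 -> e <> 0 -> x0 <> 0 ->
  c * y0 * (e * x0) = - (b * x0) ^ 2 - D ^ 2 ->
  exponent_y b c x0 y0 D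
  = b * (x0 ^ 2 * b * (e - b) - D ^ 2) / (e * D ^ 2).
Proof.
intros HD He Hx E. unfold exponent_y.
replace (c * y0) with ((- (b * x0) ^ 2 - D ^ 2) / (e * x0)).
- field. auto.
- rewrite <- E. field. auto.
Qed.

Lemma eq_iff_numerator (g1 g2 P k : R) :
  k <> 0 -> g1 - g2 = P / k -> (g1 = g2 <-> P = 0).
Proof.
intros Hk E. assert (E' : P = (g1 - g2) * k) by (rewrite E; field; exact Hk).
rewrite E'. split; intros H.
- rewrite H. ring.
- apply Rmult_integral in H. destruct H; [lra|contradiction].
Qed.

Theorem theorem1p2
  (a1 b1 c1 d1 e1 f1 a2 b2 c2 d2 e2 f2 : R)
  (h : R * R -> R) (x0 y0 D1 D2 : R) :
  let Z1 := kolmogorov a1 b1 c1 d1 e1 f1 in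
  let Z2 := kolmogorov a2 b2 c2 d2 e2 f2 in
  straight_line h ->
  CC_equilibrium Z1 Z2 h (x0, y0) ->
  monodromic Z1 Z2 (x0, y0) ->
  det2 (Jac Z1 (x0, y0)) = D1 ^ 2 ->
  det2 (Jac Z2 (x0, y0)) = D2 ^ 2 ->
  ((forall x y : R, h (x, y) = x * y0 - y * x0) ->
     (has_center Z1 Z2 h (x0, y0) <->
      D1 ^ 2 * D2 ^ 2 * (b1 * e2 - b2 * e1)
      - x0 ^ 2 * D1 ^ 2 * b2 * e1 * (b2 - e2) ^ 2
      + x0 ^ 2 * D2 ^ 2 * b1 * e2 * (b1 - e1) ^ 2 = 0)) /\
  ((forall x y : R, h (x, y) = y - y0) ->
     (has_center Z1 Z2 h (x0, y0) <->
      D1 ^ 2 * b2 ^ 2 - D1 ^ 2 * b2 * e2 - D2 ^ 2 * b1 ^ 2 + D2 ^ 2 * b1 * e1 = 0)) /\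
  ((forall x y : R, h (x, y) = x - x0) ->
     (has_center Z1 Z2 h (x0, y0) <->
      D1 ^ 2 * D2 ^ 2 * (b1 * e2 - b2 * e1)
      - x0 ^ 2 * D1 ^ 2 * b2 ^ 2 * e1 * (b2 - e2)
      + x0 ^ 2 * D2 ^ 2 * b1 ^ 2 * e2 * (b1 - e1) = 0)).
Proof.
intros Z1 Z2 _ (_ & Hz1 & Hz2 & Hc1 & Hc2) Hmono Hdet1 Hdet2.
pose proof (CC_trace_zero _ _ _ _ _ _ _ _ _ Hz1 Hc1 Hdet1) as E1.
pose proof (CC_trace_zero _ _ _ _ _ _ _ _ _ Hz2 Hc2 Hdet2) as E2.
pose proof (det_scaled _ _ _ _ _ _ _ _ _ E1) as S1.
pose proof (det_scaled _ _ _ _ _ _ _ _ _ E2) as S2.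
pose proof (e_neq_0 _ _ _ _ _ _ _ _ _ E1) as He1.
pose proof (e_neq_0 _ _ _ _ _ _ _ _ _ E2) as He2.
pose proof E1 as (Hx & Hy & HD1 & _). pose proof E2 as (_ & _ & HD2 & _).
pose proof (exponent_y_eq _ _ _ _ _ _ HD1 He1 Hx S1) as Y1.
pose proof (exponent_y_eq _ _ _ _ _ _ HD2 He2 Hx S2) as Y2.
assert (frame : forall W mu, W <> (0, 0) -> mu <> 0 ->
  (forall s, quadrant x0 y0 (section_point (x0, y0) W s) <-> 0 < s) ->
  (forall p, h p = mu * cross (fst p - x0, snd p - y0) W) ->
  section_frame (quadrant x0 y0) h (x0, y0) W mu).
{ intros W mu HW Hmu HU Hh. split; [now apply locally_quadrant|]. auto. }
subst Z1 Z2. split; [|split]; intros Hh.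
- assert (HS : section_frame (quadrant x0 y0) h (x0, y0) (x0, y0) 1).
  { apply frame; [congruence|lra| |].
    - intros s. unfold quadrant, section_point; simpl.
      replace ((x0 + (s - 1) * x0) / x0) with s by (field; assumption).
      replace ((y0 + (s - 1) * y0) / y0) with s by (field; assumption). tauto.
    - intros [x y]. rewrite Hh. unfold cross; simpl. ring. }
  rewrite (has_center_iff_exponents _ _ _ _ _ _ _ _ _ HS
    (power_section_diagonal _ _ _ _ _ _ _ _ _ E1)
    (power_section_diagonal _ _ _ _ _ _ _ _ _ E2) Hmono).
  apply eq_iff_numerator with (- (e1 * e2 * D1 ^ 2 * D2 ^ 2)).
  + apply Ropp_neq_0_compat.
    do 2 (apply Rmult_integral_contrapositive_currified;
      [|now apply pow_nonzero]).
    now apply Rmult_integral_contrapositive_currified.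
  + rewrite Y1, Y2. unfold exponent_x. field. auto.
- assert (HS : section_frame (quadrant x0 y0) h (x0, y0) (x0, 0) (- / x0)).
  { apply frame; [congruence|now apply Ropp_neq_0_compat, Rinv_neq_0_compat| |].
    - intros s. unfold quadrant, section_point; simpl.
      replace ((x0 + (s - 1) * x0) / x0) with s by (field; assumption).
      replace ((y0 + (s - 1) * 0) / y0) with 1 by (field; assumption). lra.
    - intros [x y]. rewrite Hh. unfold cross; simpl. field. assumption. }
  rewrite (has_center_iff_exponents _ _ _ _ _ _ _ _ _ HS
    (power_section_horizontal _ _ _ _ _ _ _ _ _ E1)
    (power_section_horizontal _ _ _ _ _ _ _ _ _ E2) Hmono).
  apply eq_iff_numerator with (- (D1 ^ 2 * D2 ^ 2 / x0 ^ 2)).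
  + apply Ropp_neq_0_compat. unfold Rdiv.
    apply Rmult_integral_contrapositive_currified;
      [apply Rmult_integral_contrapositive_currified
      |apply Rinv_neq_0_compat]; now apply pow_nonzero.
  + unfold exponent_x. field. auto.
- assert (HS : section_frame (quadrant x0 y0) h (x0, y0) (0, y0) (/ y0)).
  { apply frame; [congruence|now apply Rinv_neq_0_compat| |].
    - intros s. unfold quadrant, section_point; simpl.
      replace ((x0 + (s - 1) * 0) / x0) with 1 by (field; assumption).
      replace ((y0 + (s - 1) * y0) / y0) with s by (field; assumption). lra.
    - intros [x y]. rewrite Hh. unfold cross; simpl. field. assumption. }
  rewrite (has_center_iff_exponents _ _ _ _ _ _ _ _ _ HS
    (power_section_vertical _ _ _ _ _ _ _ _ _ E1)
    (power_section_vertical _ _ _ _ _ _ _ _ _ E2) Hmono).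
  apply eq_iff_numerator with (- (e1 * e2 * D1 ^ 2 * D2 ^ 2)).
  + apply Ropp_neq_0_compat.
    do 2 (apply Rmult_integral_contrapositive_currified;
      [|now apply pow_nonzero]).
    now apply Rmult_integral_contrapositive_currified.
  + rewrite Y1, Y2. field. auto.
Qed.
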